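(* Let $n$ and $k$ be two positive integers with $n\ge k\ge 4$. Then $${\rm ex}_{\mathcal{OP}}(n,P_k)=\max\{{\rm ex}'_{\mathcal{OP}}(n,P_k),\,{\rm ex}''_{\mathcal{OP}}(n,P_k)\}.$$
   Context: All graphs are finite, undirected and simple. $P_k$ denotes the path on $k$ vertices. A graph is $H$-free if it contains no (not necessarily induced) subgraph isomorphic to $H$. A graph is outerplanar if it can be embedded in the plane so that all vertices lie on the boundary of the outer face. - ${\rm ex}_{\mathcal{OP}}(n,P_k)$ is the maximum number of edges in a $P_k$-free outerplanar graph on $n$ vertices. - ${\rm ex}'_{\mathcal{OP}}(n,P_k)$ is the maximum number of edges in a connected $P_k$-free outerplanar graph on $n$ vertices. - ${\rm ex}''_{\mathcal{OP}}(n,P_k)$ is the maximum number of edges in a $P_k$-free outerplanar graph on $n$ vertices in which every connected component has at most $k-1$ vertices. *)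

(* Defs.v *)
From HB Require Import structures.
From mathcomp Require Import all_boot all_order all_algebra.
From mathcomp Require Import all_classical all_reals all_analysis.
Set Implicit Arguments.
Unset Strict Implicit.
Unset Printing Implicit Defensive.
Import Order.TTheory GRing.Theory Num.Theory.
Import numFieldNormedType.Exports.
Local Open Scope ring_scope.
Local Open Scope classical_set_scope.

(* A simple graph with vertex set T is given by its edge set, a set of
   2-element subsets of T. *)
Definition simple_graph (T : finType) (G : {set {set T}}) : bool :=
  [forall e in G, #|e| == 2%N].

Definition adj (T : finType) (G : {set {set T}}) : rel T :=
  [rel u v | [set u; v]%SET \in G].

(* Not necessarily induced. *)
Definition has_subgraph (U T : finType) (H : {set {set U}}) (G : {set {set T}}) :
    Prop :=
  exists f : U -> T, injective f /\ forall e, e \in H -> (f @: e)%SET \in G.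

(* The path on the k vertices 0, ..., k - 1. *)
Definition path_graph (k : nat) : {set {set 'I_k}} :=
  [set e : {set 'I_k} |
    [exists i : 'I_k, exists j : 'I_k,
       (j == i.+1 :> nat) && (e == [set i; j]%SET)]]%SET.

Definition path_free (T : finType) (k : nat) (G : {set {set T}}) : Prop :=
  ~ has_subgraph (path_graph k) G.

Definition component (T : finType) (G : {set {set T}}) (u : T) : {set T} :=
  [set v | connect (adj G) u v]%SET.

(* This also holds of the graph without vertices. *)
Definition connected_graph (T : finType) (G : {set {set T}}) : Prop :=
  forall u v : T, connect (adj G) u v.

Section Embedding.
Variables (R : realType) (T : finType).
Local Notation plane := (R * R)%type.

(* Vertices are drawn as points [pos v] and edges as simple arcs
   [arc e : [0, 1] -> plane]; arcs may meet each other and the vertices at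
   their ends only.  As edges carry no direction, an arc may be parametrized
   from either of its ends. *)
Record plane_embedding (G : {set {set T}})
    (pos : T -> plane) (arc : {set T} -> R -> plane) : Prop := PlaneEmbedding {
  pos_inj : injective pos;
  arc_continuous : forall e, e \in G -> {within `[0, 1], continuous (arc e)};
  arc_inj : forall e, e \in G -> {in `[0, 1]%R &, injective (arc e)};
  arc_ends : forall e, e \in G -> [set arc e 0; arc e 1] = pos @` [set` e];
  arc_avoids_vertices : forall e v t, e \in G -> t \in `]0, 1[%R ->
    arc e t <> pos v;
  arc_disjoint : forall e f s t, e \in G -> f \in G -> e != f ->
    s \in `]0, 1[%R -> t \in `]0, 1[%R -> arc e s <> arc f t
}.

Definition drawing (G : {set {set T}})
    (pos : T -> plane) (arc : {set T} -> R -> plane) : set plane :=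
  range pos `|` \bigcup_(e in [set` G]) (arc e @` `[0, 1]).

Definition face (D F : set plane) : Prop :=
  exists2 x, (~` D) x & F = connected_component (~` D) x.

(* The drawing of a finite graph is compact, hence has exactly one unbounded
   face. *)
Definition outer_face (D F : set plane) : Prop := face D F /\ ~ bounded_set F.

Definition boundary (A : set plane) : set plane := closure A `\` interior A.

Definition outerplanar (G : {set {set T}}) : Prop :=
  exists pos arc F, [/\ plane_embedding G pos arc,
    outer_face (drawing G pos arc) F & forall v, boundary F (pos v)].

End Embedding.

(* The largest number of edges of a simple graph on n labelled vertices
   satisfying P, with the value 0 if there is none. *)
Definition max_edges (n : nat) (P : {set {set 'I_n}} -> Prop) : nat :=
  \max_(G : {set {set 'I_n}} | simple_graph G && `[< P G >]) #|G|.

Definition ex_OP (R : realType) (n k : nat) : nat :=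
  max_edges (fun G : {set {set 'I_n}} => outerplanar R G /\ path_free k G).

Definition ex_OP_connected (R : realType) (n k : nat) : nat :=
  max_edges (fun G : {set {set 'I_n}} =>
    [/\ outerplanar R G, path_free k G & connected_graph G]).

Definition ex_OP_small (R : realType) (n k : nat) : nat :=
  max_edges (fun G : {set {set 'I_n}} =>
    [/\ outerplanar R G, path_free k G &
      forall u, (#|component G u| <= k - 1)%N]).

(* Main.v *)
(* An outerplanar drawing forbids four vertices all three of whose pairings are
   joined by disjoint subgraphs (this is what subdivisions of K4 and K_{2,3}
   have in common): join the four vertices through the outer face to a common
   point and count crossings with a horizontal ray; the three pairings give
   three relations between the counts, whose combination says that a sum of
   three odd numbers vanishes.

   Hence a connected graph without cut vertices is Hamiltonian, with non-crossing chords,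
   and has at most 2 m - 3 edges on m vertices.  In a P_k-free connected graph
   with m >= k vertices, two leaf lobes are traversed by a common path, so that
   the smaller one has at most s = (k - 2) / 2 vertices besides its cut vertex;
   removing it repeatedly shows that such a graph has at most 2 m - 4 - j edges
   for some j with m <= k - 1 + s j.  A component with b < k vertices has at most
   2 b - 3 edges (none if b = 1).  Adding up these bounds over the components
   gives a bound of the first kind or a bound of the second kind for the whole
   graph, and each of them is attained: the former by a vertex joined to disjoint
   paths on k - 2 - s, s, s, ... vertices, the latter by disjoint fans on k - 1
   vertices. *)
Require Import Defs.
From mathcomp Require Import all_boot.
From mathcomp Require Import boolp zify.
Set Implicit Arguments.
Unset Strict Implicit.
Unset Printing Implicit Defensive.

(** * Linked pairs and Hamiltonian cycles *)

Section Links.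
Variables (T : finType) (G : {set {set T}}).
Implicit Types (S : {set T}) (x y u v : T).

Definition adj_in S : rel T :=
  [rel x y | [&& x \in S, y \in S & adj G x y]].

(** [x \in S] is required because [connect] is reflexive; membership of [y] then follows. *)
Definition linked S x y := (x \in S) && connect (adj_in S) x y.

Definition disjointly_linked x y u v :=
  exists A B : {set T}, [/\ [disjoint A & B], linked A x y & linked B u v].

(** The counting argument uses outerplanarity only through this property. *)
Definition no_three_linked_pairings := forall x y u v,
  disjointly_linked x y u v -> disjointly_linked x u y v ->
  disjointly_linked x v y u -> False.

Lemma adj_sym : symmetric (adj G).
Proof. by move=> x y; rewrite /adj /= finset.setUC. Qed.

Lemma adj_in_sym S : symmetric (adj_in S).
Proof. by move=> x y; rewrite /adj_in /= adj_sym andbCA. Qed.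

Lemma connect_adj_in_sym S : connect_sym (adj_in S).
Proof. exact/sym_connect_sym/adj_in_sym. Qed.

Lemma linked_in S x y : linked S x y -> (x \in S) && (y \in S).
Proof.
move=> /andP[xS /connectP[p]]; rewrite xS => pp ->.
elim: p x xS pp => //= z p IH x _ /andP[/and3P[_ zS _]]; exact: IH.
Qed.

Lemma linked_sym S x y : linked S x y -> linked S y x.
Proof.
by move=> xy; rewrite /linked connect_adj_in_sym; case/andP: (linked_in xy) => _ ->;
  case/andP: xy.
Qed.

Lemma linked_trans S y x z : linked S x y -> linked S y z -> linked S x z.
Proof.
move=> /andP[xS xy] /andP[_ yz]; rewrite /linked xS; exact: connect_trans yz.
Qed.

End Links.

Section Sets.
Variables (T : finType) (G : {set {set T}}).
Implicit Types (S A B X Y : {set T}) (x y u v w : T) (p q c : seq T).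

Local Notation joined := (linked G).
Local Notation adj := (adj G).

Definition connected_set S := forall x y, x \in S -> y \in S -> joined S x y.

Definition biconnected S :=
  connected_set S /\ forall v, v \in S -> connected_set (S :\ v).

Lemma linked_refl S x : x \in S -> joined S x x.
Proof. by move=> xS; rewrite /linked xS connect0. Qed.

Lemma linked_adj S x y : x \in S -> y \in S -> adj x y -> joined S x y.
Proof. by move=> xS yS xy; rewrite /linked xS connect1 // /adj_in /= xS yS. Qed.

Lemma sub_linked A B x y : A \subset B -> joined A x y -> joined B x y.
Proof.
move=> AB /andP[xA xy]; rewrite /linked (subsetP AB) //=.
apply: connect_sub xy => u v /and3P[uA vA uv]; apply: connect1.
by rewrite /adj_in /= !(subsetP AB).
Qed.

Lemma linked_ind S (P : T -> Prop) x : P x ->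
  (forall u v, u \in S -> v \in S -> adj u v -> P u -> P v) ->
  forall y, joined S x y -> P y.
Proof.
move=> Px step y /andP[_ /connectP[p + ->]].
elim: p x Px => //= z p IH x Px /andP[/and3P[xS zS xz]]; apply: IH.
exact: step xz Px.
Qed.

Lemma path_linked S x p y : path adj x p -> {subset x :: p <= S} ->
  y \in x :: p -> joined S x y.
Proof.
elim: p x => [|z p IH] x /=.
  by move=> _ xS; rewrite inE => /eqP->; apply/linked_refl/xS; rewrite mem_head.
move=> /andP[xz pz] xzS; rewrite inE => /predU1P[->|yp].
  by apply/linked_refl/xzS; rewrite mem_head.
have zS : z \in S by apply: xzS; rewrite !inE eqxx orbT.
apply: (@linked_trans _ _ _ z).
  by apply: linked_adj => //; apply: xzS; rewrite mem_head.
by apply: IH => // w wp; apply: xzS; rewrite inE wp orbT.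
Qed.

Lemma path_linked2 S x p y z : path adj x p -> {subset x :: p <= S} ->
  y \in x :: p -> z \in x :: p -> joined S y z.
Proof.
move=> px pS yp zp; apply: (@linked_trans _ _ _ x).
  by apply: linked_sym; exact: path_linked px pS yp.
exact: path_linked px pS zp.
Qed.

Lemma disjoint_set_seq p q : (forall w, w \in p -> w \in q -> False) ->
  [disjoint [set w in p] & [set w in q]].
Proof.
by move=> pq; apply/pred0P => w /=; rewrite !inE; apply/negP => /andP[/pq].
Qed.

Lemma path_adj_in S x p : path (adj_in G S) x p -> x \in S ->
  path adj x p /\ {subset x :: p <= S}.
Proof.
move=> + xS; elim: p x xS => [|z p IH] x xS /=.
  by move=> _; split=> // w; rewrite inE => /eqP->.
move=> /andP[/and3P[_ zS ->]] /(IH z zS)[-> zpS]; split=> // w.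
by rewrite inE => /predU1P[->//|/zpS].
Qed.

Lemma linked_upath S x y : joined S x y ->
  exists p, [/\ path adj x p, uniq (x :: p), last x p = y & {subset x :: p <= S}].
Proof.
move=> /andP[xS /connectP[p pp ->]]; case/shortenP: pp => q pq uq _.
by have [? ?] := path_adj_in pq xS; exists q.
Qed.

(** A simple path is cut at its first vertex [v] in [A]; the part before [v] then lies outside
    [A]. *)
Lemma linked_first S A x y : joined S x y -> x \notin A -> y \in A ->
  exists p v, [/\ path adj x (rcons p v), uniq (x :: p), v \in A,
    {subset rcons (x :: p) v <= S} & {in x :: p, forall w, w \notin A}].
Proof.
move=> /andP[xS /connectP[p pp ->]]; case/shortenP: pp => q pq uq _ xA yA.
have [pq' qS] := path_adj_in pq xS.
have qA : has (mem A) q.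
  case: q yA {pq uq pq' qS} => [|z q] yA; first by rewrite /= (negPf xA) in yA.
  by apply/hasP; exists (last x (z :: q)); rewrite //= mem_last.
case: (split_find qA) pq' qS uq => v q1 q2 vA /hasPn q1A.
rewrite cat_path -cat_cons -rcons_cons => /andP[pq1 _] qS uq.
exists q1, v; split=> //.
- by move: uq; rewrite cat_uniq rcons_uniq => /andP[/andP[_ ->]].
- by move=> w wq; apply: qS; rewrite mem_cat wq.
- by move=> w; rewrite inE => /predU1P[->//|/q1A].
Qed.

End Sets.

Section Hamilton.
Variables (T : finType) (G : {set {set T}}).
Hypothesis links : no_three_linked_pairings G.
Implicit Types (S A B X Y : {set T}) (x y u v w : T) (p q c : seq T).

Local Notation adj := (adj G).
Local Notation joined := (linked G).

Lemma path_rev x p y : path adj x (rcons p y) -> path adj y (rcons (rev p) x).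
Proof.
move=> xy; have := rev_path adj x (rcons p y).
rewrite last_rcons belast_rcons rev_cons => ->.
by rewrite -(@eq_path _ adj) // => a b; rewrite adj_sym.
Qed.

Lemma ear_adjacent u v p q : cycle adj [:: u, v & p] -> uniq [:: u, v & p] ->
  path adj u (rcons q v) -> uniq q -> {in q, forall w, w \notin [:: u, v & p]} ->
  cycle adj (u :: q ++ v :: p) /\ uniq (u :: q ++ v :: p).
Proof.
move=> /= /andP[_ pu] /andP[uvp vp] uq qu qc; split.
  by rewrite rcons_cat rcons_cons -cat_rcons cat_path uq last_rcons.
rewrite mem_cat negb_or uvp andbT cat_uniq qu [uniq (v :: p)]vp andbT andTb.
apply/andP; split; first by apply/negP => /qc; rewrite mem_head.
apply/hasPn => w wvp; apply/negP => /qc; rewrite in_cons negb_or => /andP[_].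
by rewrite /= wvp.
Qed.

(** A vertex outside [c] yields, by connectedness of [B] and of [B :\ u], an ear from [u] through
    [x] and [q] to another vertex [v] of [c]. If [u] and [v] are neighbours on [c], the ear is
    inserted between them; otherwise cycle and ear form a subdivision of K_{2,3}, which contradicts
    [links]. *)
Lemma longer_cycle B c : biconnected G B -> cycle adj c -> uniq c ->
  {subset c <= B} -> 1 < size c < #|B| ->
  exists c', [/\ cycle adj c', uniq c', {subset c' <= B} & size c < size c'].
Proof.
move=> [conB conB'] cc uc cB /andP[c1 cltB].
have [z zB zc] : exists2 z, z \in B & z \notin c.
  apply/exists_inP;  rewrite -negb_forall_in; apply/negP => /forall_inP Bc.
  move: cltB; rewrite ltnNge => /negP; apply; rewrite -(card_uniqP uc).
  exact/subset_leq_card/subsetP.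
have [u0 u0c] : exists u0, u0 \in c by case: (c) c1 => // a *; exists a; rewrite mem_head.
have [||p [u [pu up]]] := linked_first (A := [set w in c]) (conB _ _ zB (cB _ u0c)).
- by rewrite inE.
- by rewrite inE.
rewrite inE => uc0 pB pc.
have [x [xB xc xu]] : exists x, [/\ x \in B, x \notin c & adj x u].
  exists (last z p); move: pu; rewrite rcons_path => /andP[_ xu]; split=> //.
    by apply: pB; rewrite mem_rcons inE mem_last orbT.
  by have := pc _ (mem_last _ _); rewrite inE.
have [i p0 rc] := rot_to uc0.
have sc : size c = (size p0).+1 by rewrite -(size_rot i) rc.
have mc : c =i u :: p0 by move=> w; rewrite -rc mem_rot.
have {}uc : uniq (u :: p0) by rewrite -rc rot_uniq.
have {}cc : cycle adj (u :: p0) by rewrite -rc rot_cycle.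
have {z zB zc u0 u0c p pu up pB pc rc i} p0B : {subset u :: p0 <= B}.
  by move=> w; rewrite -mc; exact: cB.
have [y yp0] : exists y, y \in p0.
  by move: c1; rewrite sc; case: (p0) => // a *; exists a; rewrite mem_head.
have uNp0 w : w \in p0 -> w \in B :\ u.
  move=> wp; rewrite !inE p0B ?inE ?wp ?orbT // andbT.
  by apply: contraTneq wp => ->; case/andP: uc.
have xBu : x \in B :\ u.
  by rewrite !inE xB andbT; apply: contraNneq xc => ->.
have [||q [v [pq uq]]] := linked_first (A := [set w in p0])
    (conB' u (p0B _ (mem_head _ _)) _ _ xBu (uNp0 _ yp0)).
- by rewrite inE; apply: contraNN xc => xp0; rewrite mc inE xp0 orbT.
- by rewrite inE.
rewrite inE => vp0 qB qc.
have xq_out w : w \in x :: q -> w \notin u :: p0.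
  move=> wq; rewrite inE negb_or; have := qc _ wq; rewrite inE => ->.
  by have := qB w; rewrite mem_rcons inE wq orbT !inE andbT => /(_ isT)/andP[].
have xqB w : w \in x :: q -> w \in B.
  by move=> wq; have := qB w; rewrite mem_rcons inE wq orbT !inE => /(_ isT)/andP[].
have uxq : path adj u (rcons (x :: q) v) by rewrite /= adj_sym xu.
(* The case in which [v] is next to [u] on the cycle, in either direction; [p2] lists the rest of
   the cycle after [v]. *)
have shortcut p2 : p0 =i v :: p2 -> size p0 = (size p2).+1 -> uniq [:: u, v & p2] ->
    cycle adj [:: u, v & p2] ->
    exists c', [/\ cycle adj c', uniq c', {subset c' <= B} & size c < size c'].
  move=> p0E sp0 up2 cp2; have [|cyc un] := ear_adjacent cp2 up2 uxq uq.
    by move=> w /xq_out; rewrite !inE p0E !inE.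
  exists (u :: (x :: q) ++ v :: p2); split=> //.
    move=> w; rewrite in_cons mem_cat => /or3P[/eqP->|/xqB//|].
      by apply: p0B; rewrite mem_head.
    by rewrite -p0E => wp; apply: p0B; rewrite in_cons wp orbT.
  by rewrite sc /= size_cat /= sp0 addnS !ltnS leq_addl.
case/splitPr: vp0 uc cc p0B shortcut xq_out qc uNp0 yp0 {sc mc} => p1 p2 uc cc p0B shortcut xq_out _ _ _.
case: p1 => [|a p1] in uc cc p0B shortcut xq_out *; first exact: (shortcut p2).
case: p2 => [|b p2] in uc cc p0B shortcut xq_out *.
  (* Here [v] precedes [u] on the cycle, which is therefore read backwards. *)
  apply: (shortcut (rev (a :: p1))).
  - by move=> w; rewrite mem_cat !inE mem_rev orbC inE.
  - by rewrite size_cat size_rev /= addn1.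
  - by move: uc; rewrite cats1 -rev_rcons !(cons_uniq u) mem_rev rev_uniq.
  - by move: cc; rewrite cats1 -rev_rcons => /path_rev.
have {}uq : uniq (u :: (x :: q) ++ (a :: p1) ++ v :: b :: p2).
  move: uc; rewrite !(cons_uniq u) => /andP[uc uc'].
  rewrite mem_cat negb_or uc cat_uniq uc' uq !andbT; apply/andP; split.
    by apply/negP => /xq_out; rewrite mem_head.
  by apply/hasPn => w wc; apply/negP => /xq_out; rewrite in_cons negb_or wc andbF.
(* [w] occurs at most once along cycle and ear; in this numerical form every disjointness below
   becomes a case analysis on booleans. *)
have H w : ((w == u) + ((w == x) + (w \in q)) + ((w == a) + (w \in p1)) +
    ((w == v) + ((w == b) + (w \in p2))) <= 1)%N.
  have := leq_b1 (w \in u :: (x :: q) ++ (a :: p1) ++ v :: b :: p2).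
  rewrite -(count_uniq_mem _ uq); have := uq.
  rewrite (cons_uniq u) 2!cat_uniq /= => /andP[_ /and3P[/andP[_ uq1] _ /and3P[/andP[_ up1] _ /and3P[_ _ up2]]]].
  rewrite /= count_cat /= count_cat /= !count_uniq_mem //.
  by rewrite !(eq_sym _ w) !addnA.
have lk s g k : sorted adj s -> g \in s -> k \in s -> joined [set w in s] g k.
  case: s => // h s hs gs ks; apply: path_linked2 hs _ gs ks => w.
  by rewrite !inE.
move: uxq cc => /= /andP[ux]; rewrite rcons_path => /andP[xq qv].
rewrite rcons_cat !rcons_cons => /andP[ua]; rewrite cat_path /= => /and3P[ap1 p1v].
rewrite rcons_path => /and3P[vb bp2 p2u].
(* The four vertices are [u] and one inner vertex of each of the three paths between [u] and [v]:
   [x] on the ear, [a] and [b] on the two arcs of the cycle. *)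
exfalso; apply: (links (x := u) (y := x) (u := a) (v := b)).
- exists [set w in u :: x :: q], [set w in a :: p1 ++ v :: b :: p2].
  split; [apply: disjoint_set_seq => w; move: (H w); rewrite !(inE, mem_cat)| |].
  + by do 5 case: (_ == _) => //; do ! case: (_ \in _).
  + by apply: lk; rewrite /= ?ux ?inE ?eqxx ?orbT.
  + by apply: lk; rewrite /= ?cat_path ?inE ?mem_cat ?inE ?eqxx ?orbT //= ap1 p1v vb.
- exists [set w in u :: a :: p1], [set w in x :: q ++ v :: b :: p2].
  split; [apply: disjoint_set_seq => w; move: (H w); rewrite !(inE, mem_cat)| |].
  + by do 5 case: (_ == _) => //; do ! case: (_ \in _).
  + by apply: lk; rewrite /= ?ua ?inE ?eqxx ?orbT.
  + by apply: lk; rewrite /= ?cat_path ?inE ?mem_cat ?inE ?eqxx ?orbT //= xq qv vb.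
- exists [set w in b :: rcons p2 u], [set w in a :: p1 ++ v :: rcons (rev q) x].
  split; [apply: disjoint_set_seq => w; move: (H w); rewrite !(inE, mem_cat, mem_rcons, mem_rev)| |].
  + by do 5 case: (_ == _) => //; do ! case: (_ \in _).
  + apply/linked_sym; apply: lk; rewrite /= ?rcons_path ?bp2 ?inE ?eqxx ?mem_rcons ?inE ?eqxx ?orbT //.
  + apply/linked_sym; apply: lk; rewrite /= ?cat_path ?inE ?mem_cat ?inE ?mem_rcons ?inE ?eqxx ?orbT //=.
    by rewrite ap1 p1v /= path_rev // rcons_path xq.
Qed.

End Hamilton.

(** * Leaf lobes and edge bounds *)

Section Branches.
Variables (T : finType) (G : {set {set T}}).
Implicit Types (S A B X Y : {set T}) (x y u v w : T) (p q c : seq T).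

Local Notation adj := (adj G).
Local Notation joined := (linked G).
Local Notation connected_set := (connected_set G).
Local Notation biconnected := (biconnected G).

Lemma connected_from S x : (forall y, y \in S -> joined S x y) -> connected_set S.
Proof.
by move=> Sx y z yS zS; apply: (linked_trans (y := x)); [apply/linked_sym|]; exact: Sx.
Qed.

Definition component_in S x := [set y | joined S x y].

Lemma component_in_sub S x : component_in S x \subset S.
Proof. by apply/subsetP => y; rewrite inE => /linked_in/andP[]. Qed.

Lemma connected_component_in S x : connected_set (component_in S x).
Proof.
apply: (connected_from (x := x)) => y; rewrite inE => xy.
have xS : x \in S by case/andP: (linked_in xy).
apply: (linked_ind (P := fun z => is_true (joined (component_in S x) x z)) _ _ xy).
  by apply: linked_refl; rewrite inE linked_refl.
move=> u v uS vS uv xu; apply: linked_trans (xu) _; case/andP: (linked_in xu) => _ uc.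
apply: linked_adj => //; move: uc; rewrite !inE => xu'.
by apply: linked_trans xu' _; exact: linked_adj.
Qed.

(** The closure condition makes [X] a connected component of the subgraph induced on [S :\ v]. *)
Definition branch S v X :=
  [/\ v \in S, X \subset S :\ v, X != set0, connected_set X &
    forall x y, x \in X -> y \in S -> adj x y -> y \in v |: X].

Lemma branch_component S v x : v \in S -> x \in S :\ v ->
  branch S v (component_in (S :\ v) x).
Proof.
move=> vS xS; split=> //.
- exact: component_in_sub.
- by apply/set0Pn; exists x; rewrite inE linked_refl.
- exact: connected_component_in.
move=> y z yc zS yz; rewrite in_setU1; case: (eqVneq z v) => //= zv.
have yS := subsetP (component_in_sub _ _) _ yc.
have zSv : z \in S :\ v by rewrite !inE zv.
by move: yc; rewrite !inE => xy; apply: linked_trans xy _; exact: linked_adj.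
Qed.

(** Some vertex of [X] is adjacent to [v]: otherwise [X] would be closed under adjacency in [S], and
    connectedness of [S] would put [v] into [X]. *)
Lemma branch_attached S v X : connected_set S -> branch S v X ->
  connected_set (v |: X).
Proof.
move=> cS [vS XS /set0Pn[x xX] cX closed].
have XsubS z : z \in X -> (z != v) && (z \in S) by move/(subsetP XS); rewrite !inE.
have [y yX yv] : exists2 y, y \in X & adj y v.
  apply: contrapT => none.
  have xS : x \in S by case/andP: (XsubS _ xX).
  have : v \in X; last by move/XsubS; rewrite eqxx.
  apply: (linked_ind (P := fun z => is_true (z \in X)) _ _ (cS x v xS vS)) => //.
  move=> a b aS bS ab aX; have := closed a b aX bS ab.
  by rewrite in_setU1 => /predU1P[bv|//]; case: none; exists a; rewrite // -bv.
apply: (connected_from (x := v)) => z; rewrite in_setU1 => /predU1P[->|zX].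
  by apply: linked_refl; rewrite setU11.
apply: (linked_trans (y := y)).
  by apply: linked_adj; rewrite ?setU11 ?setU1r // adj_sym.
by apply: sub_linked (cX y z yX zX); exact: subsetU1.
Qed.

(** A walk from [v] that enters [X] can leave it only through [v], so the vertices outside [X] are
    reached without it. *)
Lemma branch_removed S v X : connected_set S -> branch S v X ->
  connected_set (S :\: X).
Proof.
move=> cS [vS XS X0 cX closed].
have vX : v \notin X by apply/negP => /(subsetP XS); rewrite !inE eqxx.
apply: (connected_from (x := v)) => z; rewrite inE => /andP[zX zS].
have vSX : v \in S :\: X by rewrite inE vX.
have [] // : z \in X \/ joined (S :\: X) v z; last by rewrite (negPf zX).
apply: (linked_ind (P := fun z => z \in X \/ joined (S :\: X) v z) _ _ (cS v z vS zS)).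
  by right; exact: linked_refl.
move=> a b aS bS ab [aX|va].
  have := closed a b aX bS ab; rewrite in_setU1 => /predU1P[->|]; last by left.
  by right; exact: linked_refl.
case: (boolP (b \in X)) => bX; [by left|right].
apply: linked_trans (va) _; apply: linked_adj; rewrite ?inE ?bX //.
by case/andP: (linked_in va) => _; rewrite inE.
Qed.

(* A branch with fewest vertices inside X is a leaf: a cut vertex of it would
   split off a smaller branch. *)
Lemma branch_leaf S v X : connected_set S -> branch S v X ->
  exists w Y, [/\ branch S w Y, Y \subset X, w \in v |: X & biconnected (w |: Y)].
Proof.
move=> cS; have [n] := ubnP #|X|; elim: n v X => // n IH v X; rewrite ltnS => Xn bX.
have cvX := branch_attached cS bX; have [vS XS X0 cX closed] := bX.
have [bc|nbc] := pselect (biconnected (v |: X)).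
  by exists v, X; rewrite setU11.
have vX : v \notin X by apply/negP => /(subsetP XS); rewrite !inE eqxx.
(* Removing [v] from [v |: X] leaves the connected set [X], so the cut vertex is found in [X]. *)
have [w wX ncw] : exists2 w, w \in X & ~ connected_set ((v |: X) :\ w).
  apply: contra_notP nbc => /forall2NP all; split=> // w; rewrite in_setU1.
  move=> /predU1P[->|wX]; first by rewrite setU1K.
  by have [//|/contrapT] := all w.
have wv : v != w by apply: contraNneq vX => ->.
have [y yB vy] : exists2 y, y \in (v |: X) :\ w & ~~ joined ((v |: X) :\ w) v y.
  apply: contrapT => none; apply: ncw; apply: (connected_from (x := v)) => y yB.
  by apply: contrapT => /negP vy; apply: none; exists y.
(* [Y] contains neither [v] nor [w], so it is a branch at [w] strictly inside [X]. *)
set Y := component_in ((v |: X) :\ w) y.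
have vY : v \notin Y by apply: contraNN vy; rewrite inE => /linked_sym.
have YX : Y \subset X.
  apply/subsetP => z zY; have := subsetP (component_in_sub _ _) _ zY.
  rewrite !inE => /andP[_ /predU1P[zv|//]]; by rewrite -zv zY in vY.
have wY : w \notin Y.
  by apply/negP => /(subsetP (component_in_sub _ _)); rewrite !inE eqxx.
have XinS z : z \in X -> z \in S by move/(subsetP XS); rewrite !inE => /andP[].
have wvX : w \in v |: X by rewrite setU1r.
have bY : branch S w Y.
  have [_ YB Y0 cY closedY] := branch_component wvX yB.
  split=> //; first exact: XinS.
    apply/subsetP => z zY; rewrite !inE XinS ?(subsetP YX) // andbT.
    by apply: contraNneq wY => <-.
  move=> a b aY bS ab; apply: closedY (ab) => //.
  exact: closed (subsetP YX _ aY) bS ab.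
have [|w' [Y' [bY' YY' w'Y bc]]] := IH w Y _ bY.
  apply: leq_trans Xn; apply: proper_card; apply/properP; split=> //.
  by exists w.
exists w', Y'; split=> //; first exact: subset_trans YX.
move: w'Y; rewrite in_setU1 => /predU1P[->//|/(subsetP YX) ?]; exact: setU1r.
Qed.

End Branches.

(** * Edge bounds from cut vertices and Hamiltonian cycles *)

Section EdgeBounds.
Variables (T : finType) (G : {set {set T}}).
Hypothesis simple : simple_graph G.
Hypothesis links : no_three_linked_pairings G.
Implicit Types (S A B X Y : {set T}) (x y u v w : T) (p q c : seq T).

Local Notation adj := (adj G).
Local Notation joined := (linked G).
Local Notation connected_set := (connected_set G).
Local Notation biconnected := (biconnected G).
Local Notation branch := (branch G).

Lemma adj_neq x y : adj x y -> x != y.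
Proof.
move=> xy; have := forall_inP simple _ xy; rewrite cards2.
by case: (x != y).
Qed.

Lemma edge_adj e : e \in G -> exists x y, e = [set x; y] /\ adj x y.
Proof.
move=> eG; have /cards2P[x [y [_ eE]]] := forall_inP simple _ eG.
by exists x, y; rewrite /Defs.adj /= -eE.
Qed.

(** Starting from an edge, regarded as a cycle of length 2, a cycle is lengthened by [longer_cycle]
    until it covers [B]. *)
Lemma hamiltonian_path B w : biconnected B -> 1 < #|B| -> w \in B ->
  exists p, [/\ path adj w (rcons p w), uniq (w :: p) & w :: p =i B].
Proof.
move=> bB B1 wB.
suff [c [cc uc cB]] : exists c, [/\ cycle adj c, uniq c & c =i B].
  have [|i p rc] := @rot_to _ c w; first by rewrite cB.
  exists p; rewrite -rc rot_uniq; split=> //; last by move=> z; rewrite mem_rot cB.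
  by have : cycle adj (rot i c); [rewrite rot_cycle | rewrite rc].
have [u [v [uB vB uv]]] : exists u v, [/\ u \in B, v \in B & adj u v].
  have [v vB vw] : exists2 v, v \in B & v != w.
    by have [a [b [aB bB' ab]]] := card_gt1P B1; case: (eqVneq a w) => [aw|];
      [exists b; rewrite // -aw eq_sym|exists a].
  have [[|h p] [wp _ wv pB]] := linked_upath (bB.1 _ _ wB vB).
    by rewrite -wv /= eqxx in vw.
  by exists w, h; rewrite wB pB ?inE ?eqxx ?orbT //; split=> //; case/andP: wp.
have [n] : exists n, n = #|B| - size [:: u; v] by exists (#|B| - 2).
have : [/\ cycle adj [:: u; v], uniq [:: u; v], {subset [:: u; v] <= B} & 1 < size [:: u; v]].
  rewrite /= inE uv adj_sym uv adj_neq //; split=> // z.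
  by rewrite !inE => /orP[]/eqP->.
elim/ltn_ind: n [:: u; v] => n IH c [cc uc cB c1] nE.
have [full|notfull] := leqP #|B| (size c).
  exists c; split=> //.
  have sub : [set x in c] \subset B by apply/subsetP => z; rewrite inE; exact: cB.
  have /eqP <- : [set x in c] == B by rewrite eqEcard sub cardsE (card_uniqP uc).
  by move=> z; rewrite inE.
have [|c' [cc' uc' cB' cc'1]] := longer_cycle links bB cc uc cB; first by rewrite c1.
apply: (IH (#|B| - size c') _ c') => //.
  by rewrite nE; exact: ltn_sub2l.
by split=> //; exact: ltn_trans cc'1.
Qed.

Definition edges_in S := [set e in G | e \subset S].

(** Every edge inside [A :|: B] lies inside [A] or inside [B], and those inside [A :&: B] are
    counted twice on both sides. *)
Lemma edges_in_separated A B :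
  (forall x y, x \in A -> x \notin B -> y \in B -> y \notin A -> ~~ adj x y) ->
  #|edges_in (A :|: B)| + #|edges_in (A :&: B)| <= #|edges_in A| + #|edges_in B|.
Proof.
move=> sep; rewrite -[leqRHS]cardsUI; apply: leq_add; apply: subset_leq_card; last first.
  by apply/subsetP => e; rewrite !inE subsetI => /and3P[-> -> ->].
apply/subsetP => e; rewrite !inE => /andP[eG]; have [x [y [eE xy]]] := edge_adj eG.
rewrite eG eE /= !subUset !sub1set !inE => /andP[xAB yAB].
have := sep x y; have := sep y x; rewrite adj_sym xy; move: xAB yAB.
by do 4 case: (_ \in _) => //=; move=> _ _ yx xy'; first
  [by have := yx isT isT isT isT | by have := xy' isT isT isT isT].
Qed.

Lemma edges_in_small S : #|S| <= 1 -> #|edges_in S| = 0.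
Proof.
move=> S1; apply/eqP; rewrite cards_eq0 -subset0; apply/subsetP => e; rewrite !inE.
move=> /andP[eG /subset_leq_card]; rewrite (eqP (forall_inP simple _ eG)).
by move/leq_trans/(_ S1).
Qed.

Lemma disconnected_split S : ~ connected_set S -> exists A B,
  [/\ A :|: B = S, [disjoint A & B], A != set0, B != set0 &
    forall x y, x \in A -> y \in B -> ~~ adj x y].
Proof.
move=> nS.
have [x [xS [y yS xy]]] : exists x, x \in S /\ exists2 y, y \in S & ~~ joined S x y.
  apply: contrapT => none; apply: nS => x y xS yS; apply: contrapT => /negP xy.
  by apply: none; exists x; split=> //; exists y.
exists (component_in G S x), (S :\: component_in G S x); split.
- by rewrite -[RHS](setID S (component_in G S x)) (setIidPr (component_in_sub _ _ _)).
- by rewrite -setI_eq0 setDE setICA setICr setI0.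
- by apply/set0Pn; exists x; rewrite inE linked_refl.
- by apply/set0Pn; exists y; rewrite !inE xy.
move=> a b; rewrite !inE => xa /andP[xb bS]; apply: contraNN xb => ab.
by apply: linked_trans (xa) _; apply: linked_adj => //; case/andP: (linked_in xa).
Qed.

Lemma card_disjointU A B : [disjoint A & B] -> #|A :|: B| = #|A| + #|B|.
Proof. by move=> dAB; rewrite cardsU disjoint_setI0 // cards0 subn0. Qed.

(** The two sides of the cut share [v], so their bounds add up to 2 (m + 1) - 6 = 2 m - 4. The bound
    on smaller sets is a hypothesis, so that the lemma can serve inside the induction of
    [edges_in_bound]. *)
Lemma edges_in_cut_aux S v :
  (forall S', 1 < #|S'| < #|S| -> #|edges_in S'| + 3 <= 2 * #|S'|) ->
  v \in S -> ~ connected_set (S :\ v) -> #|edges_in S| + 4 <= 2 * #|S|.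
Proof.
move=> IH vS /disconnected_split[A [B [AB dAB A0 B0 noadj]]].
have vAB : v \notin A :|: B by rewrite AB !inE eqxx.
have [vA vB] : v \notin A /\ v \notin B by move: vAB; rewrite inE negb_or => /andP.
have cS : #|S| = (#|A| + #|B|).+1 by rewrite (cardsD1 v S) vS -AB card_disjointU.
have := edges_in_separated (A := v |: A) (B := v |: B).
have -> : (v |: A) :|: (v |: B) = S by rewrite setUACA setUid AB setD1K.
have IA := IH (v |: A); have IB := IH (v |: B).
move: IA IB; rewrite !cardsU1 vA vB cS /=; rewrite -!card_gt0 in A0 B0.
move=> IA IB sep; have {}sep := leq_trans (leq_addr _ _) (sep _).
have {}IA := IA _; have {}IB := IB _.
suff /sep : forall x y, x \in v |: A -> x \notin v |: B -> y \in v |: B ->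
    y \notin v |: A -> ~~ adj x y.
  have := IA; have := IB; lia.
move=> x y; rewrite !in_setU1 => xA; rewrite negb_or => /andP[xv xB] yB.
rewrite negb_or => /andP[yv yA]; apply: noadj.
  by move: xA; rewrite (negPf xv).
by move: yB; rewrite (negPf yv).
Qed.

(* A chord of a Hamiltonian cycle separates: two crossing chords would give
   three disjointly linked pairings. *)
Lemma edges_in_chord S x y p q :
  (forall S', 1 < #|S'| < #|S| -> #|edges_in S'| + 3 <= 2 * #|S'|) ->
  cycle adj (x :: p ++ y :: q) -> uniq (x :: p ++ y :: q) ->
  x :: p ++ y :: q =i S -> p != [::] -> q != [::] -> adj x y ->
  #|edges_in S| + 3 <= 2 * #|S|.
Proof.
move=> IH cS uc; have := uc; rewrite cons_uniq mem_cat negb_or cat_uniq.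
move=> /andP[/andP[xp xyq] /and3P[up /hasPn pyq uyq]] mS p0 q0 xy.
pose A := [set w in x :: rcons p y]; pose B := [set w in x :: y :: q].
have ypq : y \notin p by apply: pyq; rewrite mem_head.
have [yq uq] : y \notin q /\ uniq q by apply/andP.
have [xy' xq] : x != y /\ x \notin q by apply/andP; rewrite -negb_or -in_cons.
have cA : #|A| = (size p).+2.
  rewrite cardsE; apply: etrans (card_uniqP _) _; last by rewrite /= size_rcons.
  by rewrite /= mem_rcons inE negb_or xy' xp rcons_uniq ypq up.
have cB : #|B| = (size q).+2.
  rewrite cardsE; apply: etrans (card_uniqP _) _ => //.
  by rewrite cons_uniq xyq uyq.
have cSE : #|S| = (size p + size q).+2.
  by rewrite -(eq_card mS) (card_uniqP uc) /= size_cat /= addnS.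
have IA := IH A; have IB := IH B.
have ASB : A :|: B = S.
  apply/setP => w; rewrite -mS !inE mem_rcons mem_cat !inE.
  by case: (w \in p); case: (w \in q); case: (w == x); case: (w == y).
have ABE : A :&: B = [set x; y].
  apply/setP => w; rewrite !inE mem_rcons !inE.
  case: (eqVneq w x) => //= wx; case: (eqVneq w y) => //= wy.
  apply/negP => /andP[wp wq]; have := pyq w; rewrite inE wq orbT => /(_ isT).
  by rewrite /= wp.
(* The chord is counted on both sides, which share [x] and [y]: 2 (m + 2) - 6 - 1 = 2 m - 3. *)
have : 0 < #|edges_in (A :&: B)|.
  by rewrite ABE card_gt0; apply/set0Pn; exists [set x; y]; rewrite inE subxx andbT.
have := @edges_in_separated A B; rewrite ASB.
have sp : 0 < size p by case: (p) p0.
have sq : 0 < size q by case: (q) q0.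
rewrite cSE; rewrite cA cB cSE in IA IB.
move=> sep int; have {}sep := sep _.
have {}IA : #|edges_in A| + 3 <= 2 * (size p).+2.
  by apply: IA; rewrite !ltnS -[X in X < _]addn0 ltn_add2l.
have {}IB : #|edges_in B| + 3 <= 2 * (size q).+2.
  by apply: IB; rewrite !ltnS -[X in X < _]add0n ltn_add2r.
suff nocross : forall a b, a \in A -> a \notin B -> b \in B -> b \notin A -> ~~ adj a b.
  move: (sep nocross) int IA IB sp sq; clear; lia.
move=> a b; rewrite !inE !mem_rcons !inE => aA aB bB bA.
have ap : a \in p.
  by move: aA aB; case: (a == x); case: (a == y) => //=.
have bq : b \in q.
  by move: bB bA; case: (b == x); case: (b == y) => //=.
apply/negP => ab.
move: cS; rewrite /= rcons_cat cat_path /= rcons_path => /and4P[xpp py yqp qx].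
have in_set_seq (s : seq T) : {subset s <= [set w in s]} by move=> w; rewrite inE.
have pq w : w \in p -> w \in q -> False.
  by move=> wp wq; have := pyq w; rewrite inE wq orbT /= wp => /(_ isT).
(* One pairing is joined by the two crossing chords, the other two by opposite arcs of the cycle. *)
apply: (links (x := x) (y := y) (u := a) (v := b)).
- exists [set w in [:: x; y]], [set w in [:: a; b]]; split.
  + apply: disjoint_set_seq => w; rewrite !inE => /orP[]/eqP-> /orP[]/eqP wE.
    * by rewrite wE ap in xp.
    * by rewrite wE bq in xq.
    * by rewrite wE ap in ypq.
    * by rewrite wE bq in yq.
  + by apply: linked_adj; rewrite ?inE ?eqxx ?orbT.
  + by apply: linked_adj; rewrite ?inE ?eqxx ?orbT.
- exists [set w in x :: p], [set w in y :: q]; split.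
  + apply: disjoint_set_seq => w; rewrite !inE => /predU1P[->|wp] /predU1P[wy|wq].
    * by rewrite wy eqxx in xy'.
    * by rewrite wq in xq.
    * by rewrite -wy wp in ypq.
    * exact: pq wp wq.
  + by apply: (path_linked xpp); [exact: in_set_seq|rewrite inE ap orbT].
  + by apply: (path_linked yqp); [exact: in_set_seq|rewrite inE bq orbT].
case: p p0 up {uc pyq mS A B cA cB cSE IA IB ASB ABE sp sep int aA aB bB bA} xp ypq ap xpp py pq => // g p _ up xp ypq ap /= /andP[_ gp] py pq.
case: q q0 uq {sq uyq} xyq yq bq yqp qx pq xq => // h q _ uq xyq yq bq /= /andP[_ hq] qx pq xq.
- exists [set w in rcons (h :: q) x], [set w in rcons (g :: p) y]; split.
  + apply: disjoint_set_seq => w; rewrite !mem_rcons (in_cons x) (in_cons y).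
    move=> /predU1P[->|wq] /predU1P[wy|wp].
    * by rewrite wy eqxx in xy'.
    * by rewrite wp in xp.
    * by rewrite -wy wq in yq.
    * exact: pq wp wq.
  + apply: linked_sym; rewrite rcons_cons; apply: (path_linked2 (p := rcons q x) (x := h)).
    * by rewrite rcons_path hq.
    * exact: in_set_seq.
    * by rewrite -rcons_cons mem_rcons inE bq orbT.
    * by rewrite -rcons_cons mem_rcons mem_head.
  + rewrite rcons_cons; apply: (path_linked2 (p := rcons p y) (x := g)).
    * by rewrite rcons_path gp.
    * exact: in_set_seq.
    * by rewrite -rcons_cons mem_rcons mem_head.
    * by rewrite -rcons_cons mem_rcons inE ap orbT.
Qed.

Lemma edges_in_degree2 S x h l :
  (forall y, y \in S -> adj x y -> y = h \/ y = l) ->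
  #|edges_in S| <= #|edges_in (S :\ x)| + 2.
Proof.
move=> nb; apply: (leq_trans (n := #|edges_in (S :\ x) :|: [set [set x; h]; [set x; l]]|)).
  apply/subset_leq_card/subsetP => e; rewrite !inE => /andP[eG eS].
  rewrite eG subsetD1 eS /=; case: (boolP (x \in e)) => //= xe.
  have [a [b [eE ab]]] := edge_adj eG; apply/orP.
  have [aS bS] : a \in S /\ b \in S by rewrite eE !subUset !sub1set in eS; apply/andP.
  move: xe; rewrite eE !inE => /orP[]/eqP xE.
    have [->|->] : b = h \/ b = l by apply: nb; rewrite // xE.
      by left; rewrite xE.
    by right; rewrite xE.
  have [->|->] : a = h \/ a = l by apply: nb; rewrite // xE adj_sym.
    by left; rewrite xE setUC.
  by right; rewrite xE setUC.
rewrite (leq_trans (leq_card_setU _ _)) // leq_add2l cards2; by case: (_ != _).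
Qed.

Lemma edges_in_pair S : #|S| = 2 -> #|edges_in S| <= 1.
Proof.
move=> S2; rewrite -(cards1 S); apply/subset_leq_card/subsetP => e.
rewrite !inE => /andP[eG eS]; rewrite eqEcard eS S2.
by rewrite (eqP (forall_inP simple _ eG)).
Qed.

(** Induction, splitting [S] along components, a cut vertex, or a chord at a vertex [x] of a
    Hamiltonian cycle. If [x] has no chord, it has only its two neighbours on the cycle, and
    deleting it costs at most two edges. *)
Lemma edges_in_bound S : 1 < #|S| -> #|edges_in S| + 3 <= 2 * #|S|.
Proof.
have [n] := ubnP #|S|; elim: n S => // n IHn S; rewrite ltnS => Sn S1.
have IH S' : 1 < #|S'| < #|S| -> #|edges_in S'| + 3 <= 2 * #|S'|.
  by move=> /andP[S'1 S'S]; apply: IHn => //; exact: leq_trans Sn.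
have [cS|/disconnected_split[A [B [AB dAB A0 B0 noadj]]]] := pselect (connected_set S); last first.
  have cSE : #|S| = #|A| + #|B| by rewrite -AB card_disjointU.
  (* A part may be a single vertex, for which only 2 m - 2 holds; two such bounds still add up to 2
     m - 4. *)
  have weak X : 0 < #|X| < #|S| -> #|edges_in X| + 2 <= 2 * #|X|.
    move=> /andP[X0 XS]; have [X1|X1] := leqP #|X| 1.
      by rewrite (edges_in_small X1); move: X0; clear; lia.
    by have := IH X; rewrite X1 XS => /(_ isT); clear; lia.
  have sep : #|edges_in (A :|: B)| <= #|edges_in A| + #|edges_in B|.
    apply: leq_trans (leq_addr _ _) (edges_in_separated _).
    by move=> x y xA _ yB _; exact: noadj.
  rewrite -!card_gt0 in A0 B0.
  have := weak A; have := weak B.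
  move: A0 B0 sep; rewrite cSE AB; clear; lia.
have [[v vS ncv]|bS] := pselect (exists2 v, v \in S & ~ connected_set (S :\ v)).
  by have := edges_in_cut_aux IH vS ncv; clear; lia.
have {}bS : biconnected S.
  split=> // v vS; apply: contrapT => nc; apply: bS; by exists v.
have [S2|S3] : #|S| = 2 \/ 2 < #|S| by move: S1; clear; lia.
  by have := edges_in_pair S2; rewrite S2; clear; lia.
have [x xS] : exists x, x \in S by apply/set0Pn; rewrite -card_gt0; exact: ltnW.
have [p [xp up mp]] := hamiltonian_path bS S1 xS.
case: p xp up mp => [|h p] xp up mp.
  by have := eq_card mp; rewrite (card_uniqP up) /=; move: S3; clear; lia.
have [[y yS [xy yh yl]]|nochord] := pselect (exists2 y, y \in S & [/\ adj x y, y != h & y != last h p]).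
  have yp : y \in h :: p.
    by move: yS; rewrite -mp in_cons (eq_sym y) (negPf (adj_neq xy)).
  have [p1 [p2 hp]] : exists p1 p2, h :: p = p1 ++ y :: p2.
    by case/splitPr: yp => p1 p2; exists p1, p2.
  rewrite hp in xp up mp.
  apply: (edges_in_chord (x := x) (y := y) (p := p1) (q := p2)) => //.
  - by apply: contraNneq yh => p10; move: hp; rewrite p10 => -[-> _].
  - apply: contraNneq yl => p20; have := congr1 (last x) hp.
    by rewrite /= p20 last_cat /= => ->.
have deg : #|edges_in S| <= #|edges_in (S :\ x)| + 2.
  apply: (edges_in_degree2 (h := h) (l := last h p)) => y yS xy.
  apply: contrapT => /not_orP[/eqP yh /eqP yl].
  by apply: nochord; exists y.
have cSx : #|S| = #|S :\ x|.+1 by rewrite (cardsD1 x S) xS.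
have := IH (S :\ x); move: deg S3; rewrite cSx; clear; lia.
Qed.

Lemma edges_in_cut S v : v \in S -> ~ connected_set (S :\ v) ->
  #|edges_in S| + 4 <= 2 * #|S|.
Proof. by apply: edges_in_cut_aux => // S' /andP[+ _]; exact: edges_in_bound. Qed.

End EdgeBounds.

(** * Leaf lobes of connected graphs without long paths *)

Section PathFree.
Variables (T : finType) (G : {set {set T}}) (k s : nat).
Hypothesis simple : simple_graph G.
Hypothesis links : no_three_linked_pairings G.
Hypothesis short : forall p : seq T, sorted (adj G) p -> uniq p -> size p < k.
Hypothesis ks : k <= 2 * s + 3.
Implicit Types (S A B X Y : {set T}) (x y u v w : T) (p q c : seq T).

Local Notation adj := (adj G).
Local Notation joined := (linked G).
Local Notation connected_set := (connected_set G).
Local Notation biconnected := (biconnected G).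
Local Notation branch := (branch G).
Local Notation edges_in := (edges_in G).

(** The reverse of [p], then [w] and [q], then [p'] form a single path. *)
Lemma short_glue w p q p' : path adj w p -> path adj w q ->
  path adj (last w q) p' -> uniq (p ++ w :: q ++ p') ->
  size p + (size q).+1 + size p' < k.
Proof.
move=> wp wq qp' u; have -> : size p + (size q).+1 + size p' = size (rev p ++ w :: q ++ p').
  by rewrite size_cat size_rev /= size_cat -addnA addSn.
apply: short.
  rewrite sorted_cat_cons cat_path wq qp' !andbT -rev_cons rev_sorted /=.
  by rewrite -(@eq_path _ adj) // => a b; rewrite adj_sym.
by rewrite (perm_uniq (s2 := p ++ w :: q ++ p')) // perm_cat2r perm_rev.
Qed.

Lemma hamiltonian_start B w : biconnected (w |: B) -> w \notin B -> B != set0 ->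
  exists p, [/\ path adj w p, uniq p, p =i B & size p = #|B|].
Proof.
move=> bB wB B0; have cB : 1 < #|w |: B| by rewrite cardsU1 wB ltnS card_gt0.
have [p [wp up mp]] := hamiltonian_path simple links bB cB (setU11 _ _).
have pB : p =i B.
  move=> z; have := mp z; rewrite in_cons in_setU1.
  case: eqP => // -> _; rewrite (negPf wB); apply/negbTE; by case/andP: up.
have {}up : uniq p by case/andP: up.
exists p; split=> //; first by move: wp; rewrite rcons_path => /andP[].
by rewrite -(card_uniqP up); exact: eq_card.
Qed.

Lemma branchD S v X Y w : branch S w Y -> [disjoint X & Y] -> w \notin X ->
  branch (S :\: X) w Y.
Proof.
move=> [wS YS Y0 cY closed] dXY wX; split=> //; first by rewrite inE wX.
  apply/subsetP => z zY; have := subsetP YS z zY; rewrite !inE => /andP[-> ->].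
  by rewrite (disjointFl dXY zY).
by move=> a b aY; rewrite inE => /andP[_ bS]; exact: closed.
Qed.

(** Hamiltonian paths of the two lobes are joined by a path from [w1] to [w2] outside [Y1] and [Y2].
    As [w1 = w2] is possible, that path contributes only the [+ 1]. *)
Lemma short_lobes S w1 Y1 w2 Y2 : connected_set S ->
  branch S w1 Y1 -> branch S w2 Y2 -> [disjoint Y1 & Y2] ->
  w1 \notin Y2 -> w2 \notin Y1 -> biconnected (w1 |: Y1) -> biconnected (w2 |: Y2) ->
  #|Y1| + #|Y2| + 1 < k.
Proof.
move=> cS b1 b2 dY w1Y2 w2Y1 bc1 bc2.
have branch_notin w Y : branch S w Y -> w \notin Y.
  by case=> _ YS _ _ _; apply/negP => /(subsetP YS); rewrite !inE eqxx.
have w1Y1 := branch_notin _ _ b1; have w2Y2 := branch_notin _ _ b2.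
have c12 := branch_removed (branch_removed cS b1) (branchD w1 b2 dY w2Y1).
have [w1S _ Y10 _ _] := b1; have [w2S _ Y20 _ _] := b2.
have [||q [w1q uq lq qS]] := linked_upath (c12 w1 w2 _ _).
- by rewrite !inE w1Y2 w1Y1.
- by rewrite !inE w2Y2 w2Y1.
have [p1 [w1p1 up1 mp1 <-]] := hamiltonian_start bc1 w1Y1 Y10.
have [p2 [w2p2 up2 mp2 <-]] := hamiltonian_start bc2 w2Y2 Y20.
apply: leq_ltn_trans (@short_glue w1 p1 q p2 w1p1 w1q _ _).
- by rewrite addnS addn0 -addSn leq_add2r addnS ltnS leq_addr.
- by rewrite lq.
rewrite -cat_cons !cat_uniq up1 uq up2 !andTb andbT; apply/andP; split.
  apply/hasPn => z zq; rewrite /= mp1; move: zq; rewrite mem_cat => /orP[/qS|].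
    by rewrite !inE => /and3P[].
  by rewrite mp2 => zY2; rewrite (disjointFl dY zY2).
apply/hasPn => z /=; rewrite mp2 => zY2; apply/negP => /qS.
by rewrite !inE zY2.
Qed.

Lemma not_biconnected S : connected_set S -> ~ biconnected S ->
  exists2 v, v \in S & ~ connected_set (S :\ v).
Proof.
move=> cS nb; apply: contrapT => none; apply: nb; split=> // v vS.
by apply: contrapT => nc; apply: none; exists v.
Qed.

(** A leaf branch is taken inside each of two components of [S :\ v]. *)
Lemma two_leaves S v : connected_set S -> v \in S -> ~ connected_set (S :\ v) ->
  exists w1 Y1 w2 Y2, [/\ branch S w1 Y1, branch S w2 Y2, [disjoint Y1 & Y2],
    w1 \notin Y2 & w2 \notin Y1] /\ biconnected (w1 |: Y1) /\ biconnected (w2 |: Y2).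
Proof.
move=> cS vS nc.
have [x [xS [y yS xy]]] : exists x, x \in S :\ v /\ exists2 y, y \in S :\ v & ~~ joined (S :\ v) x y.
  apply: contrapT => none; apply: nc => x y xS yS; apply: contrapT => /negP xy.
  by apply: none; exists x; split=> //; exists y.
have bx := branch_component G vS xS; have by' := branch_component G vS yS.
have [w1 [Y1 [b1 Y1x w1x bc1]]] := branch_leaf cS bx.
have [w2 [Y2 [b2 Y2y w2y bc2]]] := branch_leaf cS by'.
have dis z : z \in component_in G (S :\ v) x -> z \in component_in G (S :\ v) y -> False.
  rewrite !inE => xz yz; move/negP: xy; apply; apply: linked_trans xz _.
  exact: linked_sym.
have vnot z : v \notin component_in G (S :\ v) z.
  by apply/negP => /(subsetP (component_in_sub _ _ _)); rewrite !inE eqxx.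
exists w1, Y1, w2, Y2; do 2?split=> //.
- by apply/pred0P => z /=; apply/negP => /andP[/(subsetP Y1x) zx /(subsetP Y2y) /(dis _ zx)].
- apply/negP => /(subsetP Y2y) wy; move: w1x; rewrite in_setU1 => /predU1P[wv|/dis/(_ wy)//].
  by rewrite wv (negPf (vnot _)) in wy.
- apply/negP => /(subsetP Y1x) wx; move: w2y; rewrite in_setU1 => /predU1P[wv|/(dis _ wx)//].
  by rewrite wv (negPf (vnot _)) in wx.
Qed.

(* Cut off the smaller of two leaf lobes: it has at most s vertices besides its
   attachment, since a path of S runs through both lobes. *)
Lemma edges_in_connected S : connected_set S -> k <= #|S| ->
  exists j, #|S| <= k - 1 + s * j /\ #|edges_in S| + 4 + j <= 2 * #|S|.
Proof.
have [n] := ubnP #|S|; elim: n S => // n IHn S; rewrite ltnS => Sn cS kS.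
have k1 : 0 < k by exact: (short (p := [::])).
(* A Hamiltonian cycle of [S] would contain a path on at least [k] vertices. *)
have nbS : ~ biconnected S.
  move=> bS; have [w wS] : exists w, w \in S.
    by apply/set0Pn; rewrite -card_gt0 (leq_trans k1).
  have [S1|S1] := leqP #|S| 1.
    have := short (p := [:: w]) isT isT; rewrite /= ltnNge => /negP; apply.
    exact: leq_trans S1.
  have [p [wp up mp]] := hamiltonian_path simple links bS S1 wS.
  have := short (p := w :: p); rewrite /= rcons_path in wp *.
  case/andP: wp => -> _ /(_ isT up); rewrite ltnNge => /negP; apply.
  by rewrite -(eq_card mp) (card_uniqP up) in kS.
have [v vS ncv] := not_biconnected cS nbS.
have [w [Y [bY bc Ys S'1]]] : exists w Y, [/\ branch S w Y, biconnected (w |: Y),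
    #|Y| <= s & 1 < #|S :\: Y|].
  have [w1 [Y1 [w2 [Y2 [[b1 b2 dY w1Y2 w2Y1] [bc1 bc2]]]]]] := two_leaves cS vS ncv.
  have lobes := short_lobes cS b1 b2 dY w1Y2 w2Y1 bc1 bc2.
  have rest w Y Y' : branch S w Y -> [disjoint Y & Y'] -> Y' != set0 ->
      w \notin Y' -> Y' \subset S -> 1 < #|S :\: Y|.
    move=> [wS YS _ _ _] dYY' /set0Pn[z zY'] wY' Y'S; apply/card_gt1P.
    exists w, z; split.
    - by rewrite inE wS andbT; apply/negP => /(subsetP YS); rewrite !inE eqxx.
    - by rewrite inE (subsetP Y'S) // (disjointFl dYY' zY').
    - by apply: contraNneq wY' => ->.
  have inS w Y : branch S w Y -> Y \subset S /\ Y != set0.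
    by case=> _ YS Y0 _ _; split=> //; apply: subset_trans YS (subsetDl _ _).
  have [Y1S Y10] := inS _ _ b1; have [Y2S Y20] := inS _ _ b2.
  have [Y12|Y21] := leqP #|Y1| #|Y2|.
    exists w1, Y1; split=> //; last exact: rest b1 dY Y20 w1Y2 Y2S.
    by move: lobes ks Y12; clear; lia.
  exists w2, Y2; split=> //; first by move: lobes ks Y21; clear; lia.
  by apply: rest b2 _ Y10 w2Y1 Y1S; rewrite disjoint_sym.
have [wS YS Y0 cY closed] := bY.
have wY : w \notin Y by apply/negP => /(subsetP YS); rewrite !inE eqxx.
have YsubS : Y \subset S by apply: subset_trans YS (subsetDl _ _).
have cardS : #|S| = #|S :\: Y| + #|Y|.
  by rewrite -(cardsID Y S) addnC (setIidPr YsubS).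
have cS' := branch_removed cS bY.
have sep : #|edges_in S| <= #|edges_in (S :\: Y)| + #|edges_in (w |: Y)|.
  have SE : (S :\: Y) :|: (w |: Y) = S.
    apply/setP => z; rewrite !inE; case: (eqVneq z w) => [->|_] /=; first by rewrite wS orbT.
    by case: (boolP (z \in Y)) => [/(subsetP YsubS)->|_]; rewrite ?orbF.
  rewrite -{1}SE; apply: leq_trans (leq_addr _ _) (edges_in_separated simple _).
  move=> x y; rewrite !in_setU1 in_setD => /andP[xY xS] /norP[xw _] yY.
  rewrite in_setD; case/predU1P: yY => [->|yY _]; first by rewrite wY wS.
  apply/negP => yx; rewrite adj_sym in yx.
  by have := closed y x yY xS yx; rewrite in_setU1 (negPf xw) (negPf xY).
have Y1 : 0 < #|Y| by rewrite card_gt0.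
have lobe : #|edges_in (w |: Y)| + 3 <= 2 * (#|Y|.+1).
  by have := edges_in_bound simple links (S := w |: Y); rewrite cardsU1 wY add1n ltnS; apply.
(* Removing the lobe loses at most [2 * #|Y| - 1] edges, one less than twice its number of vertices,
   so [j] grows by one. *)
have [kS'|S'k] := leqP k #|S :\: Y|.
  have [|j [j1 j2]] := IHn (S :\: Y) _ cS' kS'.
    by apply: leq_trans Sn; move: cardS Y1; clear; lia.
  exists j.+1; move: j1 j2 sep lobe Ys cardS; rewrite mulnS; clear; lia.
(* Fewer than [k] vertices remain. If they formed a biconnected set, a Hamiltonian path of it ending
   at [w] would continue through the lobe and cover [S]; so there is a cut vertex, and
   [edges_in_cut] applies. *)
exists 1; suff : #|edges_in (S :\: Y)| + 4 <= 2 * #|S :\: Y|.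
  by move: sep lobe Ys cardS S'k; clear; lia.
have nbS' : ~ biconnected (S :\: Y).
  move=> bS'.
  have wS' : w \in S :\: Y by rewrite inE wY.
  have [|||p [wp up mp cp]] := @hamiltonian_start ((S :\: Y) :\ w) w.
  - by rewrite setD1K.
  - by rewrite !inE eqxx.
  - by rewrite -card_gt0; move: S'1; rewrite (cardsD1 w) wS'.
  have [p' [wp' up' mp' cp']] := hamiltonian_start bc wY Y0.
  have := @short_glue w p [::] p' wp isT wp'.
  rewrite /= cat_uniq up /= up' andbT mp' wY /= => H.
  suff : ~~ (k <= #|S|) by rewrite kS.
  rewrite -ltnNge cardS (cardsD1 w) wS' -cp -cp' [_ + size p]addnC; apply: H.
  rewrite mp !inE eqxx andbT; apply/hasPn => z; rewrite mp' /= mp => zY.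
  by rewrite !inE zY andbF.
have [v' v'S nc'] := not_biconnected cS' nbS'.
exact: edges_in_cut nc'.
Qed.

End PathFree.

(* In a connected graph with more than k - 1 vertices, every s vertices beyond
   the first k - 1 cost one edge compared to 2 m - 4. *)
Definition connected_bound (k s m e : nat) :=
  exists j, m <= k - 1 + s * j /\ e + 4 + j <= 2 * m.

(* j components with at most k - 1 vertices and i isolated vertices. *)
Definition small_bound (k m e : nat) :=
  exists j i, m <= j * (k - 1) + i /\ e + 3 * j + 2 * i <= 2 * m.

Lemma small_boundD k m e m' e' : small_bound k m e -> small_bound k m' e' ->
  small_bound k (m + m') (e + e').
Proof. by move=> [j [i [? ?]]] [j' [i' [? ?]]]; exists (j + j'), (i + i'); split; nia. Qed.

(** The two constants 4 add up to 8, which leaves room for [j + j' + 4]; the 4 extra units make up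
    for the second [k - 1]. *)
Lemma connected_boundD k s m e m' e' : k - 1 <= 4 * s ->
  connected_bound k s m e -> connected_bound k s m' e' ->
  connected_bound k s (m + m') (e + e').
Proof. by move=> ks [j [? ?]] [j' [? ?]]; exists (j + j' + 4); split; nia. Qed.

(** The deficit 3 of each small component is worth 3 units of [j], enough for its [k - 1 <= 3 * s]
    vertices. *)
Lemma connected_small_boundD k s m e m' e' : 0 < s -> k - 1 <= 3 * s ->
  connected_bound k s m e -> small_bound k m' e' ->
  connected_bound k s (m + m') (e + e').
Proof.
move=> s0 ks [j [? ?]] [j' [i [? ?]]]; exists (j + 3 * j' + i); split; last by lia.
suff : j' * (k - 1) + i <= s * (3 * j' + i) by nia.
by rewrite mulnDr leq_add ?leq_pmull // mulnCA mulnA (mulnC 3) mulnC leq_mul // mulnC.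
Qed.

(* k = 5 is the only k >= 4 with k - 1 > 3 s, where s = (k - 2) / 2. *)
Lemma connected_bound5 m e : 5 <= m -> connected_bound 5 1 m e -> small_bound 5 m e.
Proof.
move=> m5 [j [mj ej]]; have [m5'|m6] := eqVneq m 5.
  by exists 1, 1; lia.
(* From [j >= m - 4] there are at most [m] edges, so three times the number of blocks, m / 4 rounded
   up, must not exceed [m]; this holds for [m >= 6] but not for [m = 5]. *)
exists ((m + 3) %/ 4), 0; lia.
Qed.

(** * Combining the bounds over the components *)

Section Dichotomy.
Variables (T : finType) (G : {set {set T}}) (k s : nat).
Hypothesis simple : simple_graph G.
Hypothesis links : no_three_linked_pairings G.
Hypothesis short : forall p : seq T, sorted (adj G) p -> uniq p -> size p < k.
Hypothesis ks : k <= 2 * s + 3.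
Hypothesis ks' : k - 1 <= 3 * s \/ k = 5 /\ s = 1.
Hypothesis k4 : 4 <= k.

(** Induction over disconnected splits: a bound of the first kind absorbs any other bound. The
    inequality [k - 1 <= 3 * s] is carried along because this absorption needs it; for [k = 5] only
    bounds of the second kind are kept. *)
Lemma edge_dichotomy (S : {set T}) :
  k - 1 <= 3 * s /\ connected_bound k s #|S| #|edges_in G S| \/
  small_bound k #|S| #|edges_in G S|.
Proof.
have [n] := ubnP #|S|; elim: n S => // n IHn S; rewrite ltnS => Sn.
have s0 : 0 < s by move: k4 ks; clear; lia.
have [cS|] := pselect (connected_set G S).
  have [kS|Sk] := leqP k #|S|.
    have cb := edges_in_connected simple links short ks cS kS.
    case: ks' => [k3s|[k5 s1]]; first by left.
    by right; rewrite k5 s1 in kS cb *; exact: connected_bound5.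
  right; have [S1|S1] := leqP #|S| 1.
    by exists 0, #|S|; rewrite (edges_in_small simple S1); clear; lia.
  by exists 1, 0; have := edges_in_bound simple links S1; move: Sk; clear; lia.
move=> /disconnected_split[A [B [AB dAB A0 B0 noadj]]].
have cSE : #|S| = #|A| + #|B| by rewrite -AB card_disjointU.
have sep : #|edges_in G S| <= #|edges_in G A| + #|edges_in G B|.
  rewrite -AB; apply: leq_trans (leq_addr _ _) (edges_in_separated simple _).
  by move=> x y xA _ yB _; exact: noadj.
rewrite -!card_gt0 in A0 B0.
have bA : #|A| < n by move: Sn cSE B0; clear; lia.
have bB : #|B| < n by move: Sn cSE A0; clear; lia.
suff : k - 1 <= 3 * s /\ connected_bound k s #|S| (#|edges_in G A| + #|edges_in G B|) \/
    small_bound k #|S| (#|edges_in G A| + #|edges_in G B|).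
  case=> [[k3s [j [mj ej]]]|[j [i [mj ej]]]].
    by left; split=> //; exists j; split=> //; move: sep ej; clear; lia.
  by right; exists j, i; split=> //; move: sep ej; clear; lia.
rewrite cSE; case: (IHn A bA) => [[k3s cA]|sA]; case: (IHn B bB) => [[k3s' cB]|sB].
- by left; split=> //; apply: connected_boundD => //; move: k3s; clear; lia.
- by left; split=> //; exact: connected_small_boundD.
- by left; split=> //; rewrite addnC [X in connected_bound _ _ _ X]addnC;
    exact: connected_small_boundD.
- by right; exact: small_boundD.
Qed.

End Dichotomy.

Lemma path_free_short (T : finType) (G : {set {set T}}) k (p : seq T) :
  path_free k G -> sorted (adj G) p -> uniq p -> size p < k.
Proof.
move=> free sp up; rewrite ltnNge; apply/negP => kp; apply: free.
case: k kp => [|k] kp.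
  case: p sp up {kp} => [|x p] _ _; last first.
    by exists (fun _ => x); split=> [[]//|e]; rewrite inE => /existsP[[]].
  have f (i : 'I_0) : T by case: i.
  by exists f; split=> [[]//|e]; rewrite inE => /existsP[[]].
have [x0 _] : exists x0 : T, True by case: (p) kp => // x; exists x.
exists (fun i : 'I_k.+1 => nth x0 p i); split.
  move=> i j /eqP; rewrite nth_uniq ?(leq_trans (ltn_ord _)) // => /eqP.
  exact: val_inj.
move=> e; rewrite inE => /existsP[i /existsP[j /andP[/eqP ij /eqP->]]].
rewrite imsetU !imset_set1 ij; have := sortedP x0 sp i; rewrite -ij.
by apply; rewrite (leq_trans (ltn_ord j)).
Qed.

Lemma path_graph_embedding (T : finType) (G : {set {set T}}) k :
  has_subgraph (path_graph k) G -> exists f : 'I_k -> T,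
    injective f /\ forall i j : 'I_k, j = i.+1 :> nat -> adj G (f i) (f j).
Proof.
move=> [f [injf fG]]; exists f; split=> // i j ij.
have := fG [set i; j]; rewrite imsetU !imset_set1; apply.
by rewrite inE; apply/existsP; exists i; apply/existsP; exists j; rewrite ij !eqxx.
Qed.

(** * Extremal graphs *)

Section OrderedGraphs.
Variables (n : nat) (r : rel nat).

Definition ordered_graph : {set {set 'I_n}} :=
  [set [set p.1; p.2] | p in [set p : 'I_n * 'I_n | (p.1 < p.2) && r p.1 p.2]].

(** Interleaved pairs are those whose edges would have to cross if drawn as arcs on one side of a
    line. *)
Definition noncrossing := forall a b c d,
  a < c -> c < b -> b < d -> r a b -> ~~ r c d.

Lemma ordered_graphP e : reflect
  (exists i j : 'I_n, [/\ i < j, r i j & e = [set i; j]]) (e \in ordered_graph).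
Proof.
apply: (iffP imsetP) => [[[i j]]|[i [j [ij rij ->]]]].
  by rewrite inE /= => /andP[ij rij] ->; exists i, j.
by exists (i, j); rewrite // inE /= ij rij.
Qed.

Lemma set2_ord_inj (i j i' j' : 'I_n) : i < j -> i' < j' ->
  [set i; j] = [set i'; j'] -> i = i' /\ j = j'.
Proof.
move=> ij ij' E.
have := set21 i j; rewrite E !inE => /orP[]/eqP i_.
  have := set22 i j; rewrite E !inE => /orP[]/eqP j_; last by [].
  by rewrite i_ j_ ltnn in ij.
have := set21 i' j'; rewrite -E !inE => /orP[]/eqP i'_; last first.
  have := set22 i j; rewrite E !inE => /orP[]/eqP j_.
    by move: ij ij'; rewrite i_ j_ => ? /ltnW; rewrite leqNgt => /negP.
  by rewrite i_ j_ ltnn in ij.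
by rewrite i'_ -i_ ltnn in ij'.
Qed.

Lemma simple_ordered_graph : simple_graph ordered_graph.
Proof.
apply/forall_inP => e /ordered_graphP[i [j [ij _ ->]]].
by rewrite cards2 -(inj_eq val_inj) neq_ltn ij.
Qed.

Lemma adj_ordered_graph (x y : 'I_n) : adj ordered_graph x y ->
  (x < y) && r x y || (y < x) && r y x.
Proof.
move=> /ordered_graphP[i [j [ij rij E]]]; case: (ltngtP x y) => [xy|yx|/val_inj xy] /=.
- by have [-> ->] := set2_ord_inj xy ij E; rewrite rij.
- by rewrite setUC in E; have [-> ->] := set2_ord_inj yx ij E; rewrite rij.
- have := set22 i j; have := set21 i j; rewrite -E xy setUid !inE.
  by move=> /eqP iE /eqP jE; rewrite iE jE ltnn in ij.
Qed.

(** Each edge is counted at its larger end [j]. *)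
Lemma card_ordered_graph :
  #|ordered_graph| = \sum_(j < n) \sum_(i < n | (i < j) && r i j) 1.
Proof.
rewrite card_in_imset.
  rewrite -sum1_card (exchange_big_dep predT) //= pair_big_dep /=.
  by apply: eq_bigl => -[i j]; rewrite inE.
move=> [i j] [i' j']; rewrite !inE /= => /andP[ij _] /andP[ij' _] E.
by have [-> ->] := set2_ord_inj ij ij' E.
Qed.

End OrderedGraphs.

(** * Fans on consecutive integers *)

Section Fans.
Variables (center : nat -> nat) (link : pred nat).

(** A centre satisfies [center j = j]; the resulting loop is discarded by the condition [p.1 < p.2]
    in [ordered_graph]. *)
Definition fan_rel : rel nat :=
  [rel i j | (i == center j) || link j && (i.+1 == j)].

Hypothesis center_mono : {homo center : i j / i <= j}.
Hypothesis center_idem : forall i, center (center i) = center i.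

(** Nothing lies strictly between consecutive integers, so only edges to centres matter. If
    [a = center b], [c = center d] and [c < b], then [c = center c <= center b = a]. *)
Lemma noncrossing_fan : noncrossing fan_rel.
Proof.
move=> a b c d ac cb bd; rewrite /fan_rel /= => /orP[/eqP aE|/andP[_ /eqP aE]]; last first.
  by move: cb; rewrite -aE ltnS => ca; have := leq_ltn_trans ca ac; rewrite ltnn.
apply/negP => /orP[/eqP cE|/andP[_ /eqP cE]]; last first.
  by move: bd; rewrite -cE ltnS => db; have := leq_ltn_trans db cb; rewrite ltnn.
have := center_mono (ltnW cb); rewrite -aE {1}cE center_idem -cE.
by rewrite leqNgt ac.
Qed.

Hypothesis center_link : forall j, link j -> center j < j.-1.
Hypothesis center_le : forall j, center j <= j.

(** By [center_link], the centre and the predecessor of a linked vertex are distinct, so both edges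
    count. *)
Lemma card_fan_graph n :
  \sum_(j < n) ((center j != j) + link j) <= #|ordered_graph n fan_rel|.
Proof.
rewrite card_ordered_graph; apply: leq_sum => j _.
have [lj|_] := boolP (link j); last first.
  rewrite addn0; case: eqP => //= /eqP cj.
  have cltj : center j < j by rewrite ltn_neqAle cj center_le.
  rewrite (bigD1 (Ordinal (ltn_trans cltj (ltn_ord j)))) ?leq_addr //=.
  by rewrite cltj /fan_rel /= eqxx.
have cj := center_link lj.
have j0 : 0 < j by case: (val j) cj.
have pj : j.-1 < j by rewrite prednK.
have cltj := ltn_trans cj pj.
rewrite (bigD1 (Ordinal (ltn_trans cltj (ltn_ord j)))) /=; last by rewrite cltj /fan_rel /= eqxx.
rewrite (bigD1 (Ordinal (ltn_trans pj (ltn_ord j)))) /=.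
  by rewrite addnA (leq_trans _ (leq_addr _ _)) //; case: (center j != j).
by rewrite pj /fan_rel /= lj prednK // eqxx orbT -(inj_eq val_inj) /= gtn_eqF.
Qed.

End Fans.

Lemma card_ord_interval n a b (A : {set 'I_n}) :
  (forall v, v \in A -> a <= v < a + b) -> #|A| <= b.
Proof.
move=> Aab; rewrite cardE -(size_map val) -(size_iota a b).
apply: uniq_leq_size; first by rewrite map_inj_uniq ?enum_uniq //; exact: val_inj.
by move=> _ /mapP[v + ->]; rewrite mem_enum mem_iota => /Aab.
Qed.

(* The vertex 0 is joined to all others, which form paths (lobes): the first one
   on k - 2 - s vertices, the others on s vertices. *)
Section Star.
Variables (k s n : nat).
Hypothesis s0 : 0 < s.
Hypothesis sk : 2 * s + 2 <= k.

(** Vertex 0 gets the value 0 although it belongs to no lobe; hence the guards [1 < j] and [0 < v]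
    below. *)
Definition lobe j := if j < k - 1 - s then 0 else ((j - (k - 1 - s)) %/ s).+1.

Definition star_link j := (1 < j) && (lobe j == lobe j.-1).

Definition star_graph := ordered_graph n (fan_rel (fun=> 0) star_link).

Lemma lobe_mono : {homo lobe : i j / i <= j}.
Proof.
move=> i j ij; rewrite /lobe; case: ifP => // iN; rewrite ifF; last first.
  by apply/negbTE; rewrite -leqNgt (leq_trans _ ij) // leqNgt iN.
by rewrite ltnS leq_div2r // leq_sub2r.
Qed.

Lemma noncrossing_star : noncrossing (fan_rel (fun=> 0) star_link).
Proof. exact: noncrossing_fan. Qed.

Lemma star_graph_connected : connected_graph star_graph.
Proof.
suff to0 (z x : 'I_n) : z = 0 :> nat -> connect (adj star_graph) z x.
  move=> x y; have n0 : 0 < n by exact: leq_ltn_trans (ltn_ord x).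
  rewrite (@connect_trans _ _ (Ordinal n0)) //; last exact: to0.
  rewrite (sym_connect_sym (@adj_sym _ _)); exact: to0.
move=> z0; have [->|xz] := eqVneq x z; first exact: connect0.
have zx : z < x by rewrite ltn_neqAle z0 leq0n andbT -z0 eq_sym (inj_eq val_inj).
by apply: connect1; apply/ordered_graphP; exists z, x; split; rewrite // /fan_rel /= z0.
Qed.

Lemma lobe_adj (x y : 'I_n) : x != 0 :> nat -> y != 0 :> nat ->
  adj star_graph x y -> lobe x = lobe y.
Proof.
move=> x0 y0 /adj_ordered_graph; rewrite /fan_rel /star_link /= (negPf x0) (negPf y0) /=.
by case/orP => /and3P[_ /andP[_ /eqP lE] /eqP E]; rewrite lE -E.
Qed.

Lemma card_lobe t : #|[set v : 'I_n | (0 < v) && (lobe v == t)]| <=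
  if t is 0 then k - 2 - s else s.
Proof.
case: t => [|t].
  apply: (card_ord_interval (a := 1)) => v; rewrite inE => /andP[-> /eqP].
  by rewrite /lobe; case: ifP => // vk _; move: vk; clear; lia.
apply: (card_ord_interval (a := k - 1 - s + t * s)) => v; rewrite inE => /andP[_ /eqP].
rewrite /lobe; case: ltnP => // kv [] vt.
have := leq_trunc_div (v - (k - 1 - s)) s; have := ltn_ceil (v - (k - 1 - s)) s0.
by rewrite vt mulSn; move: kv; clear; lia.
Qed.

(** A path passes through 0 at most once, so its other vertices lie in the lobes of its two ends: at
    most 1 + (k - 2 - s) + s = k - 1 vertices in all. *)
Lemma star_graph_path_free : path_free k star_graph.
Proof.
have [k' kE] : exists k', k = k'.+1 by exists k.-1; move: sk; clear; lia.
rewrite /path_free kE => /path_graph_embedding[f [injf fadj]].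
pose g i := f (inord i).
have gadj i : i < k' -> adj star_graph (g i) (g i.+1).
  by move=> ik; apply: fadj; rewrite !inordK // ltnS // ltnW.
have ginj i j : i <= k' -> j <= k' -> g i = g j -> i = j.
  by move=> ik jk /injf/(congr1 val); rewrite /= !inordK.
have before i : i <= k' -> (forall j, j <= i -> g j != 0 :> nat) -> lobe (g i) = lobe (g 0).
  elim: i => // i IH ik nz; rewrite -IH; last 2 first.
  - exact: ltnW.
  - by move=> j ji; apply: nz; exact: leqW.
  by apply/esym/lobe_adj; [exact: nz|exact: nz|exact: gadj].
have after d i : i + d = k' -> (forall j, i <= j <= k' -> g j != 0 :> nat) ->
    lobe (g i) = lobe (g k').
  elim: d i => [|d IH] i; first by rewrite addn0 => ->.
  rewrite addnS => ik nz; rewrite -(IH i.+1) ?addSn //; last first.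
    by move=> j /andP[ij jk]; apply: nz; rewrite (ltnW ij).
  have ik' : i < k' by rewrite -ik ltnS leq_addr.
  by apply: lobe_adj; [apply: nz|apply: nz|exact: gadj]; rewrite ?leqnn ?leqnSn ?(ltnW ik') ?ik'.
pose L t := [set v : 'I_n | (0 < v) && (lobe v == t)].
have sub : f @: setT \subset [set v : 'I_n | v == 0 :> nat] :|: (L (lobe (g 0)) :|: L (lobe (g k'))).
  apply/subsetP => _ /imsetP[i _ ->]; rewrite -(inord_val i) -/(g i) !inE.
  have ik : i <= k' by rewrite -ltnS.
  rewrite lt0n; case: eqP => //= gi.
  have [bf|nbf] := pselect (forall j, j <= i -> g j != 0 :> nat).
    by rewrite before // eqxx.
  have [af|naf] := pselect (forall j, i <= j <= k' -> g j != 0 :> nat).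
    by rewrite (after (k' - i)) ?subnKC // eqxx orbT.
  (* The path meets 0 both up to [i] and from [i] on, hence at [i] itself by injectivity. *)
  have [a [ai ga]] : exists a, a <= i /\ g a = 0 :> nat.
    apply: contrapT => none; apply: nbf => j ji; apply/eqP => gj; by apply: none; exists j.
  have [b [ib bk gb]] : exists b, [/\ i <= b, b <= k' & g b = 0 :> nat].
    apply: contrapT => none; apply: naf => j /andP[ij jk]; apply/eqP => gj.
    by apply: none; exists j.
  have ab : a = b by apply: ginj => //; [exact: leq_trans ik|apply: val_inj; rewrite /= ga gb].
  by case: gi; rewrite (_ : i = a :> nat) //; apply/eqP; rewrite eqn_leq ai ab ib.
have := subset_leq_card sub; rewrite card_imset // cardsT card_ord.
have zero : #|[set v : 'I_n | v == 0 :> nat]| <= 1.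
  by apply: (card_ord_interval (a := 0)) => v; rewrite inE => /eqP->.
(* Of two distinct lobes at most one is the first, larger one. *)
have two : #|L (lobe (g 0)) :|: L (lobe (g k'))| <= k - 2.
  have sk' : s <= k - 2 - s by move: sk; clear; lia.
  have [->|ne] := eqVneq (lobe (g 0)) (lobe (g k')).
    rewrite setUid (leq_trans (card_lobe _)) //; case: (lobe _); move: sk' sk; clear; lia.
  rewrite (leq_trans (leq_card_setU _ _)) // (leq_trans (leq_add (card_lobe _) (card_lobe _))) //.
  by case: (lobe (g 0)) (lobe (g k')) ne => [|?] [|?] //= _; move: sk' sk; clear; lia.
move=> H; have := leq_trans H (leq_trans (leq_card_setU _ _) (leq_add zero two)).
by move: kE sk; clear; lia.
Qed.

Lemma card_star_graph e : k <= n -> connected_bound k s n e -> e <= #|star_graph|.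
Proof.
move=> kn [j [nj ej]].
apply: leq_trans (card_fan_graph _ _ _) => //; last first.
  by move=> i /andP[i1 _]; case: i i1 => [|[]].
(* A vertex beyond 1 has two smaller neighbours unless it starts a new lobe, where [lobe]
   increases. *)
have count m : 2 * m.+2 <= \sum_(j < m.+2) ((0 != j) + star_link j) + lobe m.+1 + 3.
  elim: m => [|m IH].
    by rewrite !big_ord_recr big_ord0 /star_link /=; clear; lia.
  rewrite big_ord_recr /= {2}/star_link /=; have := lobe_mono (leqnSn m.+1).
  by case: (eqVneq (lobe m.+2) (lobe m.+1)) IH => [->|] /=; clear; lia.
have := count (n - 2).
have -> : (n - 2).+2 = n by move: kn sk; clear; lia.
have : lobe (n - 2).+1 <= j.+1.
  rewrite /lobe; case: ifP => // nk; rewrite ltnS -ltnS ltn_divLR //.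
  by rewrite mulSn mulnC; move: nj kn sk s0 nk; clear; lia.
by move: ej; clear; lia.
Qed.

End Star.

(* Disjoint fans on m consecutive vertices each, apart from the last one. *)
Section Blocks.
Variables (m n : nat).
Hypothesis m0 : 2 < m.

Definition block_center j := j %/ m * m.

(** At residue 1 the predecessor is already the centre; at residue 0 it belongs to the preceding
    block. *)
Definition block_link j := 1 < j %% m.

Definition block_graph := ordered_graph n (fan_rel block_center block_link).

Let m_gt0 : 0 < m. Proof. exact: ltn_trans m0. Qed.

Lemma block_center_le j : block_center j <= j.
Proof. exact: leq_trunc_div. Qed.

Lemma block_center_mono : {homo block_center : i j / i <= j}.
Proof. by move=> i j ij; rewrite leq_mul2r leq_div2r ?orbT. Qed.

Lemma block_center_idem i : block_center (block_center i) = block_center i.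
Proof. by rewrite /block_center mulnK. Qed.

Lemma noncrossing_blocks : noncrossing (fan_rel block_center block_link).
Proof. by apply: noncrossing_fan; [exact: block_center_mono|exact: block_center_idem]. Qed.

Lemma block_adj (x y : 'I_n) : adj block_graph x y -> x %/ m = y %/ m.
Proof.
have lt_eq i j : fan_rel block_center block_link i j -> i %/ m = j %/ m.
  move=> /orP[/eqP->|/andP[lj /eqP ij]]; first by rewrite mulnK.
  rewrite -ij in lj *; rewrite divnS //; case: (boolP (m %| i.+1)) => [|_] //.
  by rewrite /dvdn /block_link in lj * => /eqP; move: lj => /[swap] ->.
by move=> /adj_ordered_graph/orP[]/andP[_ /lt_eq].
Qed.

Lemma card_block (x : 'I_n) : #|[set v : 'I_n | x %/ m == v %/ m]| <= m.
Proof.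
apply: (card_ord_interval (a := x %/ m * m)) => v; rewrite inE => /eqP->.
by rewrite leq_trunc_div /= -mulSnr ltn_ceil.
Qed.

Lemma block_connect (x y : 'I_n) : connect (adj block_graph) x y -> x %/ m = y %/ m.
Proof.
by move=> /connectP[p + ->]; elim: p x => //= z p IH x /andP[/block_adj-> /IH].
Qed.

Lemma card_block_component (x : 'I_n) : #|component block_graph x| <= m.
Proof.
apply: leq_trans (card_block x); apply/subset_leq_card/subsetP => v.
by rewrite !inE => /block_connect->.
Qed.

Lemma block_graph_path_free : path_free m.+1 block_graph.
Proof.
move=> /path_graph_embedding[f [injf fadj]].
have same i : i <= m -> f ord0 %/ m = f (inord i) %/ m.
  elim: i => [_|i IH im]; first by congr (f _ %/ m); apply: val_inj; rewrite /= inordK.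
  rewrite IH; last exact: ltnW.
  by apply: block_adj; apply: fadj; rewrite !inordK // ltnS // ltnW.
have sub : f @: setT \subset [set v : 'I_n | f ord0 %/ m == v %/ m].
  apply/subsetP => _ /imsetP[i _ ->]; rewrite inE -(inord_val i); apply/eqP/same.
  by rewrite -ltnS.
have := leq_trans (subset_leq_card sub) (card_block _).
by rewrite card_imset // cardsT card_ord ltnn.
Qed.

Lemma card_block_graph e : small_bound m.+1 n e -> e <= #|block_graph|.
Proof.
move=> [J [I [nJI eJI]]]; rewrite subn1 /= in nJI.
apply: leq_trans (card_fan_graph _ _ _); last 2 first.
- move=> j lj; rewrite /block_center /block_link in lj *.
  rewrite {2}(divn_eq j m) -subn1 -addnBA; last exact: ltnW.
  by rewrite -[X in X < _]addn0 ltn_add2l subn_gt0.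
- exact: block_center_le.
have bcE j : (block_center j != j) + block_link j = (0 < j %% m) + (1 < j %% m).
  by rewrite lt0n {2}(divn_eq j m) -[X in X != _]addn0 eqn_add2l eq_sym.
have -> : \sum_(j < n) ((block_center j != j) + block_link j) =
    \sum_(j < n) ((0 < j %% m) + (1 < j %% m)) by apply: eq_bigr => j _; exact: bcE.
have one_block N : N <= m -> 2 * N <= \sum_(j < N) ((0 < j %% m) + (1 < j %% m)) + 3.
  elim: N => // N IH Nm; rewrite big_ord_recr /= modn_small //.
  by have := IH (ltnW Nm); case: N {IH Nm} => [|[|N]] /=; rewrite ?big_ord0; clear; lia.
(* Full blocks are peeled off at a deficit of 3 each. A last block of at most [m] vertices is
   handled by [one_block]; once [J'] is used up, at most [I] vertices remain, at a deficit of 2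
   each. *)
have defect N J' : N <= J' * m + I ->
    2 * N <= \sum_(j < N) ((0 < j %% m) + (1 < j %% m)) + 3 * J' + 2 * I.
  elim: J' N => [|J' IH] N.
    by rewrite mul0n add0n; clear; lia.
  move=> NJ; have [Nm|mN] := leqP N m.
    by apply: leq_trans (one_block N Nm) _; clear; lia.
  have [N' NE] : exists N', N = m + N' by exists (N - m); rewrite subnKC // ltnW.
  rewrite {N mN}NE in NJ *.
  have shift : \sum_(j < m + N') ((0 < j %% m) + (1 < j %% m)) =
      \sum_(j < m) ((0 < j %% m) + (1 < j %% m)) +
      \sum_(j < N') ((0 < j %% m) + (1 < j %% m)).
    rewrite big_split_ord /=; congr (_ + _).
    by apply: eq_bigr => i _; rewrite modnDl.
  have rest : N' <= J' * m + I by move: NJ; rewrite mulSn; clear; lia.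
  by have := IH _ rest; have := one_block m (leqnn m); rewrite shift; clear; lia.
by have := defect n J nJI; move: eJI; clear; lia.
Qed.

End Blocks.

From mathcomp Require Import all_boot all_classical all_reals.
From mathcomp Require Import all_order all_algebra all_analysis ring lra.
Import Order.TTheory GRing.Theory Num.Theory numFieldNormedType.Exports.

(** * Crossing numbers of chains in the plane *)

Section Winding.
Local Open Scope ring_scope.
Variable R : realType.
Local Notation plane := (R * R)%type.
Implicit Types (u v a b x y z : plane) (s t : seq plane) (e d : R).

Lemma norm_ltE u d : (`|u| < d) = (`|u.1| < d) && (`|u.2| < d).
Proof. by rewrite prod_normE gt_max. Qed.

Lemma norm_geE u d : (d <= `|u|) = (d <= `|u.1|) || (d <= `|u.2|).
Proof. by rewrite prod_normE le_max. Qed.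

(* The half plane is half-open at 0: it contains exactly one of u and -u when u
   is nonzero. *)
Definition upper u : int := ((0 < u.2) || (u.2 == 0) && (0 < u.1))%:Z.

(* The signed number of crossings of the positive horizontal axis when moving
   from u to v, provided that u and v are close compared to their norms. *)
Definition crossing u v : int := if 0 < u.1 + v.1 then upper v - upper u else 0.

Lemma upper_oppD u : u != 0 -> upper u + upper (- u) = 1.
Proof.
case: u => u1 u2; rewrite /upper /= xpair_eqE negb_and oppr_eq0 !oppr_gt0.
by case: (ltgtP u1 0); case: (ltgtP u2 0).
Qed.

Lemma upper_gt u : 0 < u.2 -> upper u = 1.
Proof. by rewrite /upper => ->. Qed.

Lemma upper_lt u : u.2 < 0 -> upper u = 0.
Proof. by move=> u2; rewrite /upper ltNge (ltW u2) lt_eqF. Qed.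

(** All four points are within [2 * e] of [u] in the maximum norm, while some coordinate of [u] is
    at least [4 * e] in size. Either the second coordinates keep their sign and every crossing is 0,
    or the first ones do and the crossings telescope or all vanish. *)
Lemma crossing_square u u' v v' e : 0 < e ->
  `|u' - u| < e -> `|v - u| < e -> `|v' - u'| < e -> 4 * e <= `|u| ->
  crossing u u' + crossing u' v' = crossing u v + crossing v v'.
Proof.
move=> e0; rewrite !norm_ltE norm_geE /=.
case: u u' v v' => [u1 u2] [u1' u2'] [v1 v2] [v1' v2'] /=.
rewrite !ltr_norml => /andP[/andP[? ?] /andP[? ?]] /andP[/andP[? ?] /andP[? ?]].
move=> /andP[/andP[? ?] /andP[? ?]]; rewrite !ler_normr /crossing /=.
have [|] := lerP (3 * e) u2; last have [|] := lerP (3 * e) (- u2).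
- by move=> h _; rewrite !upper_gt ?subrr ?if_same //=; lra.
- by move=> h _ _; rewrite !upper_lt ?subrr ?if_same //=; lra.
move=> h1 h2 /orP[/orP[h|h]|/orP[h|h]]; try by exfalso; lra.
- have pos (x y : R) : e <= x -> e <= y -> (0 < x + y) = true by lra.
  by rewrite !pos; [ring|lra..].
- have neg (x y : R) : e <= - x -> e <= - y -> (0 < x + y) = false.
    by move=> *; apply/negbTE; rewrite -leNgt; lra.
  by rewrite !neg; [ring|lra..].
Qed.

(** If the first coordinates keep their sign, exactly one of the two steps is on the right and
    records the change of [upper]; if the second ones do, all terms are 0. *)
Lemma crossing_opp u v e : 0 < e -> `|v - u| < e -> 2 * e <= `|u| ->
  crossing u v - crossing (- u) (- v) = upper v - upper u.
Proof.
move=> e0 uv eu; have u0 : u != 0 by rewrite -normr_gt0; lra.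
have v0 : v != 0.
  have := ler_normD v (u - v); rewrite addrC subrK distrC -normr_gt0; lra.
move: (upper_oppD u0) (upper_oppD v0) uv eu => hu hv.
rewrite norm_ltE norm_geE /crossing.
have -> : upper (- u) = 1 - upper u by lia.
have -> : upper (- v) = 1 - upper v by lia.
rewrite {hu hv u0 v0}.
case: u v => [u1 u2] [v1 v2] /=.
rewrite !ltr_norml !ler_normr => /andP[/andP[? ?] /andP[? ?]].
have [|] := lerP (2 * e) u2; last have [|] := lerP (2 * e) (- u2).
- by move=> h _; rewrite !upper_gt ?subrr ?if_same //=; lra.
- by move=> h _ _; rewrite !upper_lt ?subrr ?if_same //=; lra.
move=> h1 h2 /orP[/orP[h|h]|/orP[h|h]]; try by exfalso; lra.
- by rewrite ifT ?ifF; [ring|apply/negbTE; rewrite -leNgt; lra|lra].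
- by rewrite ifF ?ifT; [ring|lra|apply/negbTE; rewrite -leNgt; lra].
Qed.

(** For small steps and [f a = a - b], this counts the signed crossings of the chain with the
    horizontal ray starting at [b]. *)
Fixpoint turn (f : plane -> plane) x s : int :=
  if s is y :: s' then crossing (f x) (f y) + turn f y s' else 0.

Definition small_steps e : rel plane := [rel x y | `|y - x| < e].

Lemma turn_opp b x s e : 0 < e -> path (small_steps e) x s ->
  (forall a, a \in x :: s -> 2 * e <= `|a - b|) ->
  turn (fun a => a - b) x s - turn (fun a => b - a) x s =
  upper (last x s - b) - upper (x - b).
Proof.
move=> e0; elim: s x => [|y s IH] x /=; first by rewrite !subrr.
move=> /andP[xy ys] far.
have far' : forall a, a \in y :: s -> 2 * e <= `|a - b|.
  by move=> a ha; apply: far; rewrite inE ha orbT.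
have := IH y ys far'.
have := @crossing_opp (x - b) (y - b) e e0; rewrite opprB addrA subrK.
move=> /(_ xy (far _ (mem_head _ _))); rewrite !opprB => h1 h2.
by rewrite opprD addrACA h1 h2 addrC addrA subrK.
Qed.

(* The turn of a - b around the boundary of a grid of differences is 0. *)
Lemma turn_grid x s y t e : 0 < e ->
  path (small_steps e) x s -> path (small_steps e) y t ->
  (forall a b, a \in x :: s -> b \in y :: t -> 4 * e <= `|a - b|) ->
  turn (fun a => a - y) x s + turn (fun b => last x s - b) y t =
  turn (fun b => x - b) y t + turn (fun a => a - last y t) x s.
Proof.
move=> e0; elim: s x => [|x' s IH] x /=; first by rewrite add0r addr0.
move=> /andP[xx' xs] yt far.
have {}IH : turn (fun a => a - y) x' s + turn (fun b => last x' s - b) y t =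
    turn (fun b => x' - b) y t + turn (fun a => a - last y t) x' s.
  by apply: IH => // a b ha; apply: far; rewrite inE ha orbT.
rewrite -addrA IH addrA addrA; congr (_ + _).
have {IH}far b : b \in y :: t -> 4 * e <= `|x - b|.
  by apply: far; rewrite mem_head.
(* What remains is the strip between [x] and [x'], filled square by square. *)
elim: t y yt far => [|y' t IH] y /=; first by rewrite add0r addr0.
move=> /andP[yy' yt] far.
rewrite addrA (@crossing_square (x - y) (x' - y) (x - y') (x' - y') e) //.
- rewrite -addrA IH ?addrA // => b hb; apply: far; by rewrite inE hb orbT.
- by rewrite opprB addrA subrK.
- by rewrite opprB addrC addrA subrK distrC.
- by rewrite opprB addrC addrA subrK distrC.
- by apply: far; rewrite mem_head.
Qed.

Definition far e s t := forall a b, a \in s -> b \in t -> 4 * e <= `|a - b|.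

(* The paths between x and y and between u and v are disjoint, and the paths
   from z only meet them at their own ends: then the turns along the former
   cancel, which leaves a relation between the paths from z. *)
Lemma turn_pairing e x y u v z sxy suv sx sy su sv : 0 < e ->
  path (small_steps e) x sxy -> last x sxy = y ->
  path (small_steps e) u suv -> last u suv = v ->
  path (small_steps e) z sx -> last z sx = x ->
  path (small_steps e) z sy -> last z sy = y ->
  path (small_steps e) z su -> last z su = u ->
  path (small_steps e) z sv -> last z sv = v ->
  far e (x :: sxy) (u :: suv) ->
  far e (z :: sx) (u :: suv) -> far e (z :: sy) (u :: suv) ->
  far e (z :: su) (x :: sxy) -> far e (z :: sv) (x :: sxy) ->
  let w s b := turn (fun a => a - b) z s in
  w sy u - w sx u - w sy v + w sx v - w sv x + w su x + w sv y - w su y =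
  upper (u - x) - upper (v - x) + upper (v - y) - upper (u - y).
Proof.
move=> e0 pxy lxy puv luv px lx py ly pu lu pv lv f fx fy fu fv w.
have far_sym s t : far e s t -> far e t s.
  by move=> st a b hb ha; rewrite distrC; exact: st.
(* The turns along [sxy] and [suv] are sides shared between the five grids and cancel in the final
   combination. *)
have g := turn_grid e0 pxy puv f; have gx := turn_grid e0 px puv fx.
have gy := turn_grid e0 py puv fy.
have gu := turn_grid e0 pxy pu (far_sym _ _ fu).
have gv := turn_grid e0 pxy pv (far_sym _ _ fv).
have opp s b : path (small_steps e) z s -> far e (z :: s) (x :: sxy) ->
    b \in x :: sxy -> w s b - turn (fun a => b - a) z s =
    upper (last z s - b) - upper (z - b).
  move=> ps fs hb; apply: turn_opp ps _ => // a ha.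
  by apply: le_trans (fs _ _ ha hb); lra.
have y_xy : y \in x :: sxy by rewrite -lxy mem_last.
have := opp su x pu fu (mem_head _ _); have := opp sv x pv fv (mem_head _ _).
have := opp su y pu fu y_xy; have := opp sv y pv fv y_xy.
move: g gx gy gu gv; rewrite lxy luv lx ly lu lv -!/(w _ _).
lia.
Qed.

End Winding.

(** * Discrete chains and the parity contradiction *)

Section Chains.
Local Open Scope ring_scope.
Local Open Scope classical_set_scope.
Variable R : realType.
Local Notation plane := (R * R)%type.
Implicit Types (x y z : plane) (A B C D K T : set plane) (e d : R).

(** A discrete form of connectedness, which lets crossings be counted by finite sums. *)
Definition chained K x y := forall e, 0 < e -> exists s,
  [/\ path (small_steps e) x s, last x s = y & forall a, a \in x :: s -> K a].

Definition sep_by e A B := forall a b, A a -> B b -> 4 * e <= `|a - b|.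

(** As a condition on all small [e], finitely many instances hold for a common [e]. *)
Definition apart A B := \forall e \near 0^'+, sep_by e A B.

(** Each pairing gives a relation by [turn_pairing]. In the first minus the second plus the third,
    every turn cancels or is doubled, while the [upper] terms add up to an odd number because
    [upper (a - b) + upper (b - a) = 1]. *)
Lemma no_three_pairings (x y u v z : plane)
    (Kxy Kuv Kxu Kyv Kxv Kyu Tx Ty Tu Tv : set plane) :
  chained Kxy x y -> chained Kuv u v ->
  chained Kxu x u -> chained Kyv y v ->
  chained Kxv x v -> chained Kyu y u ->
  chained Tx z x -> chained Ty z y -> chained Tu z u -> chained Tv z v ->
  apart Kxy Kuv -> apart Kxu Kyv -> apart Kxv Kyu ->
  apart Tx Kuv -> apart Tx Kyv -> apart Tx Kyu ->
  apart Ty Kuv -> apart Ty Kxu -> apart Ty Kxv ->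
  apart Tu Kxy -> apart Tu Kyv -> apart Tu Kxv ->
  apart Tv Kxy -> apart Tv Kxu -> apart Tv Kyu ->
  False.
Proof.
move=> cxy cuv cxu cyv cxv cyu cx cy cu cv.
move=> a1 a2 a3 x1 x2 x3 y1 y2 y3 u1 u2 u3 v1 v2 v3.
near (0 : R)^'+ => e.
have e0 : 0 < e by near: e; exact: nbhs_right_gt.
have s_a1 : sep_by e Kxy Kuv by near: e; exact: a1.
have s_a2 : sep_by e Kxu Kyv by near: e; exact: a2.
have s_a3 : sep_by e Kxv Kyu by near: e; exact: a3.
have s_x1 : sep_by e Tx Kuv by near: e; exact: x1.
have s_x2 : sep_by e Tx Kyv by near: e; exact: x2.
have s_x3 : sep_by e Tx Kyu by near: e; exact: x3.
have s_y1 : sep_by e Ty Kuv by near: e; exact: y1.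
have s_y2 : sep_by e Ty Kxu by near: e; exact: y2.
have s_y3 : sep_by e Ty Kxv by near: e; exact: y3.
have s_u1 : sep_by e Tu Kxy by near: e; exact: u1.
have s_u2 : sep_by e Tu Kyv by near: e; exact: u2.
have s_u3 : sep_by e Tu Kxv by near: e; exact: u3.
have s_v1 : sep_by e Tv Kxy by near: e; exact: v1.
have s_v2 : sep_by e Tv Kxu by near: e; exact: v2.
have s_v3 : sep_by e Tv Kyu by near: e; exact: v3.
have sep_far A B s t : sep_by e A B -> (forall a, a \in s -> A a) ->
    (forall b, b \in t -> B b) -> far e s t.
  by move=> AB sA tB a b /sA ? /tB ?; apply: AB.
have far_sym s t : far e s t -> far e t s.
  by move=> st a b hb ha; rewrite distrC; exact: st.
have [s1 [p1 l1 k1]] := cxy e e0; have [s2 [p2 l2 k2]] := cuv e e0.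
have [s3 [p3 l3 k3]] := cxu e e0; have [s4 [p4 l4 k4]] := cyv e e0.
have [s5 [p5 l5 k5]] := cxv e e0; have [s6 [p6 l6 k6]] := cyu e e0.
have [sx [px lx kx]] := cx e e0; have [sy [py ly ky]] := cy e e0.
have [su [pu lu ku]] := cu e e0; have [sv [pv lv kv]] := cv e e0.
have := turn_pairing e0 p1 l1 p2 l2 px lx py ly pu lu pv lv
  (sep_far _ _ _ _ s_a1 k1 k2) (sep_far _ _ _ _ s_x1 kx k2) (sep_far _ _ _ _ s_y1 ky k2)
  (sep_far _ _ _ _ s_u1 ku k1) (sep_far _ _ _ _ s_v1 kv k1).
have := turn_pairing e0 p3 l3 p4 l4 px lx pu lu py ly pv lv
  (sep_far _ _ _ _ s_a2 k3 k4) (sep_far _ _ _ _ s_x2 kx k4) (sep_far _ _ _ _ s_u2 ku k4)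
  (sep_far _ _ _ _ s_y2 ky k3) (sep_far _ _ _ _ s_v2 kv k3).
have := turn_pairing e0 p5 l5 p6 l6 px lx pv lv py ly pu lu
  (sep_far _ _ _ _ s_a3 k5 k6) (sep_far _ _ _ _ s_x3 kx k6) (sep_far _ _ _ _ s_v3 kv k6)
  (sep_far _ _ _ _ s_y3 ky k5) (sep_far _ _ _ _ s_u3 ku k5).
have opp a b A B : sep_by e A B -> A a -> B b ->
    upper (a - b) + upper (b - a) = 1.
  move=> /[apply]/[apply] ab; rewrite -(opprB a b) upper_oppD // -normr_gt0; lra.
have end_in A a s b : (forall c, c \in a :: s -> A c) -> last a s = b -> A b.
  by move=> sA <-; apply: sA; exact: mem_last.
have := opp _ _ _ _ s_a1 (k1 _ (mem_head _ _)) (k2 _ (mem_head _ _)).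
have := opp _ _ _ _ s_a1 (k1 _ (mem_head _ _)) (end_in _ _ _ _ k2 l2).
have := opp _ _ _ _ s_a1 (end_in _ _ _ _ k1 l1) (k2 _ (mem_head _ _)).
have := opp _ _ _ _ s_a1 (end_in _ _ _ _ k1 l1) (end_in _ _ _ _ k2 l2).
have := opp _ _ _ _ s_a2 (k3 _ (mem_head _ _)) (k4 _ (mem_head _ _)).
have := opp _ _ _ _ s_a2 (end_in _ _ _ _ k3 l3) (end_in _ _ _ _ k4 l4).
rewrite /=.
lia.
Unshelve. all: by end_near.
Qed.
End Chains.

(** * Outerplanar drawings *)

Section Plane.
Local Open Scope ring_scope.
Local Open Scope classical_set_scope.
Variable R : realType.
Local Notation plane := (R * R)%type.
Implicit Types (x y z : plane) (A B C D K T : set plane) (e d r : R).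

Lemma nbhs_norm_ballP x A : nbhs x A <-> exists2 r, 0 < r & forall y, `|y - x| < r -> A y.
Proof.
split=> [/nbhs_ballP[r r0]|[r r0 rA]].
  by rewrite -ball_normE => rA; exists r => // y yx; apply: rA; rewrite /= distrC.
by apply/nbhs_ballP; exists r => //; rewrite -ball_normE => y /=; rewrite distrC => /rA.
Qed.

Lemma sub_apart A A' B B' : A' `<=` A -> B' `<=` B -> apart A B -> apart A' B'.
Proof.
by move=> AA BB; rewrite /apart; apply: filterS => e AB a b /AA ? /BB ?; exact: AB.
Qed.

Lemma apartU A A' B : apart A B -> apart A' B -> apart (A `|` A') B.
Proof.
by rewrite /apart; apply: filterS2 => e AB A'B a b [Aa|Aa] Bb; [exact: AB|exact: A'B].
Qed.

Lemma apart_dist A B r : 0 < r -> (forall a b, A a -> B b -> r <= `|a - b|) ->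
  apart A B.
Proof.
move=> r0 AB; rewrite /apart; near=> e => a b Aa Bb; apply: le_trans (AB _ _ Aa Bb).
suff : e < r / 4 by lra.
by near: e; apply: nbhs_right_lt; lra.
Unshelve. all: by end_near. Qed.

Lemma closed_dist D y : closed D -> ~ D y ->
  exists2 r, 0 < r & forall a b, `|a - y| < r -> D b -> r <= `|a - b|.
Proof.
move=> /closed_openC oD Dy.
have /nbhs_norm_ballP[r r0 rD] : nbhs y (~` D) by apply: open_nbhs_nbhs.
exists (r / 2) => [|a b ay Db]; first by lra.
rewrite leNgt; apply/negP => ab; apply: (rD b) => //.
rewrite (le_lt_trans (ler_distD a _ _)) // distrC; lra.
Qed.

(** [closed_dist] gives a bound near each point of [A], and compactness, in its near-covering form,
    makes it uniform. *)
Lemma compact_apart A B : compact A -> closed B -> A `&` B = set0 -> apart A B.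
Proof.
move=> /compact_near_coveringP cA clB AB.
have : \forall e \near 0^'+, A `<=` (fun a => forall b, B b -> 4 * e <= `|a - b|).
  apply: (cA _ _ (fun e a => forall b, B b -> 4 * e <= `|a - b|)) => a Aa.
  have [|r r0 rB] := closed_dist (y := a) clB.
    by move=> Ba; have : (A `&` B) a by []; rewrite AB.
  near=> a' e.
  have a'r : `|a' - a| < r by near: a'; apply/nbhs_norm_ballP; exists r.
  have er : e < r / 4 by near: e; apply: nbhs_right_lt; lra.
  by move=> b /= /(rB _ _ a'r); lra.
by rewrite /apart; apply: filterS => e AB' a b /AB'; apply.
Unshelve. all: by end_near. Qed.

Definition segment x y := (fun t : R => x + t *: (y - x)) @` `[0, 1].

Lemma segmentl x y : segment x y x.
Proof. by exists 0; rewrite /= ?in_itv /= ?lexx ?ler01 // scale0r addr0. Qed.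

Lemma segmentr x y : segment x y y.
Proof. by exists 1; rewrite /= ?in_itv /= ?lexx ?ler01 // scale1r addrC subrK. Qed.

Lemma connected_segment x y : connected (segment x y).
Proof.
apply: connected_continuous_connected; first exact: segment_connected.
apply: continuous_subspaceT => t; apply: cvgD; first exact: cvg_cst.
by apply: cvgZl; exact: cvg_id.
Qed.

Lemma segment_near x y a : segment x y a -> `|a - x| <= `|y - x|.
Proof.
move=> [t]; rewrite /= in_itv /= => /andP[t0 t1] <-.
by rewrite addrC addrA addNr add0r normrZ ger0_norm // ler_piMl.
Qed.

(** [P] is locally constant on [K], so it holds on a relatively clopen, nonempty subset. *)
Lemma connected_ind K (P : set plane) x : connected K -> K x -> P x ->
  (forall b, K b -> exists2 r, 0 < r & forall c c', K c -> K c' ->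
     `|c - b| < r -> `|c' - b| < r -> P c -> P c') ->
  K `<=` P.
Proof.
move=> cK Kx Px loc.
suff <- : K `&` P = K by move=> b [].
apply: cK; first by exists x.
  exists [set c | K c -> P c]°; first exact: open_interior.
  apply/seteqP; split=> [b [Kb Pb]|b [Kb /interior_subset/(_ Kb)//]].
  split=> //; have [r r0 rP] := loc b Kb; apply/nbhs_norm_ballP; exists r => // c bc Kc.
  by apply: rP Pb => //; rewrite subrr normr0.
exists (~` [set c | K c -> ~ P c]°); first exact/open_closedC/open_interior.
apply/seteqP; split=> [b [Kb Pb]|b [Kb nPb]].
  by split=> // /interior_subset/(_ Kb).
split=> //; apply: contrapT => Pb; apply: nPb.
have [r r0 rP] := loc b Kb; apply/nbhs_norm_ballP; exists r => // c bc Kc Pc.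
by apply: Pb; apply: rP Pc => //; rewrite subrr normr0.
Qed.

(** Two points within [e / 2] of a third are one step apart, so reachability by [e]-chains is
    locally constant. *)
Lemma connected_chained K x y : connected K -> K x -> K y -> chained K x y.
Proof.
move=> cK Kx Ky e e0.
pose P b := exists s, [/\ path (small_steps e) x s, last x s = b &
  forall a, a \in x :: s -> K a].
apply: (connected_ind (P := P) cK Kx _ _ Ky).
  by exists [::]; split => // a; rewrite inE => /eqP->.
move=> b Kb; exists (e / 2) => [|c c' Kc Kc' cb cb' [s [ps ls sK]]]; first lra.
exists (rcons s c'); split.
- rewrite rcons_path ps ls /small_steps /=.
  by rewrite (le_lt_trans (ler_distD b _ _)) // (distrC b); lra.
- by rewrite last_rcons.
- move=> a; rewrite -rcons_cons mem_rcons inE => /predU1P[->//|]; exact: sK.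
Qed.

(* Components of an open set are connected by sets keeping a positive distance
   from the complement. *)
Lemma component_apart D x y : closed D -> connected_component (~` D) x y ->
  exists T, [/\ connected T, T x, T y & apart T D].
Proof.
move=> cD xy; have Dx : ~ D x.
  by move=> Dx; rewrite connected_component_out in xy.
pose P b := exists T, [/\ connected T, T x, T b & apart T D].
apply: (connected_ind (P := P) (@component_connected _ _ x) _ _ _ xy).
- exact: connected_component_refl.
- have [r r0 rD] := closed_dist cD Dx.
  exists [set x]; split=> //; first exact: connected1.
  by apply: (apart_dist r0) => a b -> /rD; apply; rewrite subrr normr0.
move=> b /connected_component_sub Db; have [r r0 rD] := closed_dist cD Db.
exists r => // c c' _ _ cb cb' [T [cT Tx Tc TD]].
have near_b z : `|z - b| < r -> apart (segment b z) D.
  move=> zb; apply: (apart_dist r0) => a d /segment_near az Dd.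
  by apply: rD => //; exact: le_lt_trans zb.
exists (T `|` (segment b c `|` segment b c')); split.
- apply: connectedU => //; first by exists c; split=> //; left; exact: segmentr.
  apply: connectedU; [|exact: connected_segment|exact: connected_segment].
  by exists b; split; exact: segmentl.
- by left.
- by right; right; exact: segmentr.
- by apply: apartU => //; apply: apartU; exact: near_b.
Qed.

(* A boundary point p of a face is accessible up to an arbitrarily short
   segment, which may cross the drawing D but stays away from K. *)
Lemma boundary_access D K x p : closed D -> ~ D x ->
  closure (connected_component (~` D) x) p ->
  closed K -> K `<=` D -> ~ K p ->
  exists2 T, chained T x p & apart T K.
Proof.
move=> cD Dx clp cK KD Kp; have [r r0 rK] := closed_dist cK Kp.
have [|q [xq pq]] := clp [set q | `|q - p| < r].
  by apply/nbhs_norm_ballP; exists r.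
have [T [cT Tx Tq TD]] := component_apart cD xq.
exists (T `|` segment p q).
  apply: connected_chained; [|by left|by right; exact: segmentl].
  apply: connectedU => //; [|exact: connected_segment].
  by exists q; split => //; exact: segmentr.
apply: apartU; first exact: sub_apart TD.
apply: (apart_dist r0) => a b /segment_near ap; apply: rK.
exact: le_lt_trans pq.
Qed.

Lemma compact_bigcup_fin (I : finType) (P : set I) (F : I -> set plane) :
  (forall i, P i -> compact (F i)) -> compact (\bigcup_(i in P) F i).
Proof.
move=> cF; have -> : P = [set` enum [pred i | `[< P i >]]].
  by apply/seteqP; split=> i; rewrite /= mem_enum inE.
rewrite bigcup_seq big_seq; apply: bigsetU_compact => i.
by rewrite mem_enum inE; exact: cF.
Qed.

End Plane.

(** * Drawings of induced subgraphs *)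

Section OuterplanarLinks.
Local Open Scope ring_scope.
Local Open Scope classical_set_scope.
Variables (R : realType) (T : finType) (G : {set {set T}}).
Variables (pos : T -> R * R) (arc : {set T} -> R -> R * R).
Hypothesis emb : plane_embedding G pos arc.
Implicit Types (A B : {set T}) (v x y : T) (q : R * R).

Definition drawn A : set (R * R) := (pos @` [set` A]) `|`
  \bigcup_(e in [set e : {set T} | (e \in G) && (e \subset A)]) (arc e @` `[0, 1]).

Lemma drawnP A q : drawn A q -> (exists2 v, v \in A & q = pos v) \/
  exists e t, [/\ e \in G, e \subset A, t \in `]0, 1[%R & q = arc e t].
Proof.
case=> [[v vA <-]|[e /= /andP[eG eA] [t]]]; first by left; exists v.
rewrite /= in_itv /= => /andP[t0 t1] <-.
have ends s : s = 0 \/ s = 1 -> exists2 v, v \in A & arc e s = pos v.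
  move=> s01; have : [set arc e 0; arc e 1] (arc e s) by case: s01 => ->; [left|right].
  by rewrite (arc_ends emb eG) => -[v ve <-]; exists v => //; exact: (fintype.subsetP eA).
move: t0; rewrite le_eqVlt => /predU1P[<-|t0]; first by left; apply: ends; left.
move: t1; rewrite le_eqVlt => /predU1P[->|t1]; first by left; apply: ends; right.
by right; exists e, t; rewrite in_itv /= t0 t1.
Qed.

Lemma compact_drawn A : compact (drawn A).
Proof.
apply: compactU; first exact/finite_compact/finite_image/finite_finset.
apply: compact_bigcup_fin => e /= /andP[eG _].
apply: continuous_compact; first exact: arc_continuous emb _ eG.
exact: segment_compact.
Qed.

Lemma drawn_sub A B : A \subset B -> drawn A `<=` drawn B.
Proof.
move=> /fintype.subsetP AB q [[v vA <-]|[e /= /andP[eG eA] qe]].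
  by left; exists v => //=; exact: AB.
by right; exists e => //=; rewrite eG (fintype.subset_trans eA) //; apply/fintype.subsetP.
Qed.

Lemma drawn_setT : drawn [set: T]%SET = drawing G pos arc.
Proof.
rewrite /drawn /drawing; congr (_ `|` _).
  by congr (_ @` _); apply/seteqP; split=> v //=; rewrite finset.in_setT.
by congr (\bigcup_(e in _) _); apply/seteqP; split=> e /=; rewrite finset.subsetT andbT.
Qed.

(** Drawn vertices and arcs meet only at ends of arcs, and a common edge would have its ends in both
    [A] and [B]. *)
Lemma drawn_disjoint A B : [disjoint A & B]%B -> drawn A `&` drawn B = set0.
Proof.
move=> dAB; apply/seteqP; split=> // q [/drawnP qA /drawnP qB].
case: qA => [[v vA ->]|[e [t [eG eA te ->]]]] in qB *.
  case: qB => [[w wB /(pos_inj emb) vw]|[f [s [fG fB sf /esym]]]].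
    by have := disjointFr dAB vA; rewrite vw wB.
  exact: arc_avoids_vertices emb _ _ _ fG sf.
case: qB => [[w wB]|[f [s [fG fB sf]]]].
  exact: arc_avoids_vertices emb _ _ _ eG te.
apply: (arc_disjoint emb eG fG) te sf; apply/eqP => ef.
have : [set arc e 0; arc e 1] (arc e 0) by left.
rewrite (arc_ends emb eG) => -[v ve _].
have := disjointFr dAB (fintype.subsetP eA _ ve).
by rewrite (fintype.subsetP fB) // -ef.
Qed.

Lemma drawn_chained A x y : linked G A x y -> chained (drawn A) (pos x) (pos y).
Proof.
move=> /andP[xA /connectP[p]].
suff : path (adj_in G A) x p -> exists C : set (R * R),
    [/\ connected C, C (pos x), C (pos (last x p)) & C `<=` drawn A].
  move=> /[apply] -[C [cC Cx Cy CA]] -> e /(connected_chained cC Cx Cy)[s [ps ls sC]].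
  by exists s; split=> // a /sC /CA.
elim: p x xA => [|z p IH] x xA /=.
  move=> _; exists [set pos x]; split=> //; first exact: connected1.
  by move=> _ ->; left; exists x.
move=> /andP[/and3P[_ zA xz]] /(IH z zA)[C [cC Cz Cl CA]].
have e_ends := arc_ends emb xz.
have in_arc w : w \in [set x; z]%SET -> (arc [set x; z]%SET @` `[0, 1]) (pos w).
  move=> we; have : [set arc [set x; z]%SET 0; arc [set x; z]%SET 1] (pos w).
    by rewrite e_ends; exists w.
  case=> ->; [exists 0|exists 1] => //=; rewrite in_itv /= ?lexx ?ler01 //.
exists ((arc [set x; z]%SET @` `[0, 1]) `|` C); split.
- apply: connectedU => //; first by exists (pos z); split=> //; apply: in_arc; rewrite set22.
  apply: connected_continuous_connected; first exact: segment_connected.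
  exact: arc_continuous emb _ xz.
- by left; apply: in_arc; rewrite set21.
- by right.
- move=> q [qe|/CA//]; right; exists [set x; z]%SET => //=.
  apply/andP; split=> //.
  by apply/fintype.subsetP => w; rewrite finset.in_set2 => /orP[]/eqP->.
Qed.

End OuterplanarLinks.

Lemma outerplanar_linked (R : realType) (T : finType) (G : {set {set T}}) :
  outerplanar R G -> no_three_linked_pairings G.
Proof.
move=> [pos [arc [F [emb [[q0 q0D ->] _] bd]]]] x y u v.
move=> [A1 [B1 [d1 l1 m1]]] [A2 [B2 [d2 l2 m2]]] [A3 [B3 [d3 l3 m3]]].
have cD A : closed (drawn G pos arc A).
  by apply: compact_closed; [exact: norm_hausdorff|exact: compact_drawn].
(* Taking for [K] the drawing of all vertices but [w] serves every [B] that misses [w] at once. *)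
have access w : exists2 C, chained C q0 (pos w) &
    forall A B : {set T}, [disjoint A & B]%B -> w \in A -> apart C (drawn G pos arc B).
  have [| | | | |C Cw CK] := @boundary_access R (drawn G pos arc [set: T]%SET)
    (drawn G pos arc (~: [set w])%SET) q0 (pos w) (cD _).
  - by rewrite drawn_setT.
  - by have [+ _] := bd w; rewrite drawn_setT.
  - exact: cD.
  - exact/drawn_sub/finset.subsetT.
  - move=> Kw; have := drawn_disjoint emb (A := [set w]%SET) (B := (~: [set w])%SET).
    rewrite -setI_eq0 finset.setICr eqxx => /(_ isT)/seteqP[+ _] => /(_ (pos w)); apply.
    by split=> //; left; exists w => //=; rewrite finset.set11.
  exists C => // A B dAB wA; apply: sub_apart CK => //; apply: drawn_sub.
  apply/fintype.subsetP => b bB; rewrite !inE; apply: contraTneq bB => ->.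
  by rewrite (disjointFr dAB wA).
have disj (A B : {set T}) : [disjoint A & B]%B -> apart (drawn G pos arc A) (drawn G pos arc B).
  move=> dAB; apply: compact_apart => //; first exact: compact_drawn.
  exact: drawn_disjoint.
have [/andP[xA1 yA1] /andP[uB1 vB1]] := (linked_in l1, linked_in m1).
have [/andP[xA2 uA2] /andP[yB2 vB2]] := (linked_in l2, linked_in m2).
have [/andP[xA3 vA3] /andP[yB3 uB3]] := (linked_in l3, linked_in m3).
have [[X cX aX] [Y cY aY]] := (access x, access y).
have [[U cU aU] [V cV aV]] := (access u, access v).
have ds (A B : {set T}) : [disjoint A & B]%B -> [disjoint B & A]%B by rewrite disjoint_sym.
apply: (no_three_pairings (drawn_chained emb l1) (drawn_chained emb m1)
  (drawn_chained emb l2) (drawn_chained emb m2) (drawn_chained emb l3)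
  (drawn_chained emb m3) cX cY cU cV); do ?[exact: disj].
- exact: aX d1 _.
- exact: aX d2 _.
- exact: aX d3 _.
- exact: aY d1 _.
- exact: aY (ds _ _ d2) _.
- exact: aY (ds _ _ d3) _.
- exact: aU (ds _ _ d1) _.
- exact: aU d2 _.
- exact: aU (ds _ _ d3) _.
- exact: aV (ds _ _ d1) _.
- exact: aV (ds _ _ d2) _.
- exact: aV d3 _.
Qed.

(** * Drawing noncrossing graphs below a line *)

Section BookDrawing.
Local Open Scope ring_scope.
Local Open Scope classical_set_scope.
Variables (R : realType) (n : nat) (r : rel nat).
Hypothesis ncr : noncrossing r.
Local Notation plane := (R * R)%type.

Definition line_pos (v : 'I_n) : plane := ((v : nat)%:R, 0).

Definition parabola (a b t : R) : plane :=
  (a + t * (b - a), - ((b - a) ^+ 2 * (t * (1 - t)))).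

(** An edge is an unordered pair, so [pick] recovers its ends in increasing order; the default 0
    concerns only sets that are not pairs. *)
Definition book_arc (e : {set 'I_n}) : R -> plane :=
  if [pick p : 'I_n * 'I_n | (p.1 < p.2)%N && (e == [set p.1; p.2]%SET)] is Some p
  then parabola (p.1 : nat)%:R (p.2 : nat)%:R else fun=> 0.

Lemma book_arcE (i j : 'I_n) : (i < j)%N ->
  book_arc [set i; j]%SET = parabola (i : nat)%:R (j : nat)%:R.
Proof.
move=> ij; rewrite /book_arc; case: pickP => [[i' j'] /= /andP[ij' /eqP E]|/(_ (i, j))].
  by have [-> ->] := set2_ord_inj ij ij' E.
by rewrite /= ij eqxx.
Qed.

Lemma parabola_continuous (a b : R) : continuous (parabola a b).
Proof.
move=> t; apply: (@cvg_pair _ _ _ (nbhs t) (nbhs (parabola a b t).1)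
  (nbhs (parabola a b t).2) _ _ _ (fun t => a + t * (b - a))
  (fun t => - ((b - a) ^+ 2 * (t * (1 - t))))).
  apply: cvgD; first exact: cvg_cst.
  by apply: cvgM; [exact: cvg_id|exact: cvg_cst].
apply: cvgN; apply: cvgM; first exact: cvg_cst.
by apply: cvgM; [exact: cvg_id|apply: cvgB; [exact: cvg_cst|exact: cvg_id]].
Qed.

(* The point of abscissa x of the arc from a to b has ordinate -(x - a)(b - x). *)
Lemma parabola_meet (a b c d s t : R) : a < b -> c < d -> 0 < s < 1 -> 0 < t < 1 ->
  parabola a b s = parabola c d t ->
  [/\ a < d, c < b, a < c -> b < d & a = c -> b = d].
Proof.
move=> ab cd /andP[s0 s1] /andP[t0 t1] [xE yE].
set x := a + s * (b - a) in xE.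
have xa : s * (b - a) = x - a by rewrite /x; ring.
have bx : (1 - s) * (b - a) = b - x by rewrite /x; ring.
have xc : t * (d - c) = x - c by rewrite xE; ring.
have dx : (1 - t) * (d - c) = d - x by rewrite xE; ring.
have {}yE : (x - a) * (b - x) = (x - c) * (d - x).
  rewrite -xa -bx -xc -dx; transitivity ((b - a) ^+ 2 * (s * (1 - s))); first by ring.
  by rewrite (oppr_inj yE); ring.
have xa0 : 0 < x - a by rewrite -xa mulr_gt0 // subr_gt0.
have bx0 : 0 < b - x by rewrite -bx mulr_gt0 // subr_gt0.
have xc0 : 0 < x - c by rewrite -xc mulr_gt0 // subr_gt0.
have dx0 : 0 < d - x by rewrite -dx mulr_gt0 // subr_gt0.
split; [lra|lra| |].
(* If [d <= b], the arc from [c] to [d] is nested and lies strictly above the other one at abscissa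
   [x]. *)
- move=> ac; rewrite ltNge; apply/negP => db.
  have : (x - c) * (d - x) < (x - a) * (b - x).
    by apply: (lt_le_trans (y := (x - a) * (d - x))); rewrite ?ltr_pM2r ?ler_pM2l //; lra.
  by rewrite yE ltxx.
- by move=> ac; move: yE; rewrite ac => /(mulfI (lt0r_neq0 xc0)); lra.
Qed.

Lemma book_embedding : plane_embedding (ordered_graph n r) line_pos book_arc.
Proof.
have lt_nat (i j : 'I_n) : (i < j)%N -> ((i : nat)%:R : R) < (j : nat)%:R by rewrite ltr_nat.
split.
- by move=> v w [/eqP]; rewrite eqr_nat => /eqP/val_inj.
- move=> _ /ordered_graphP[i [j [ij _ ->]]]; rewrite book_arcE //.
  exact/continuous_subspaceT/parabola_continuous.
- move=> _ /ordered_graphP[i [j [ij _ ->]]] s t _ _; rewrite book_arcE // => -[+ _].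
  by move=> /addrI/mulIf; apply; rewrite subr_eq0 gt_eqF // lt_nat.
- move=> _ /ordered_graphP[i [j [ij _ ->]]]; rewrite book_arcE //.
  have -> : parabola (i : nat)%:R (j : nat)%:R 0 = line_pos i.
    by rewrite /parabola /line_pos !mul0r mulr0 oppr0 addr0.
  have -> : parabola (i : nat)%:R (j : nat)%:R 1 = line_pos j.
    by rewrite /parabola /line_pos subrr mul1r !mulr0 oppr0 addrC subrK.
  apply/seteqP; split=> [q [->|->]|q [v]].
  + by exists i => //=; rewrite finset.set21.
  + by exists j => //=; rewrite finset.set22.
  + by rewrite /= finset.in_set2 => /orP[]/eqP-> <-; [left|right].
- move=> _ v t /ordered_graphP[i [j [ij _ ->]]]; rewrite in_itv /= => /andP[t0 t1].
  rewrite book_arcE // => -[_ /eqP]; rewrite oppr_eq0; apply/negP.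
  have := lt_nat _ _ ij; rewrite -subr_gt0 => ji.
  by rewrite gt_eqF // mulr_gt0 ?exprn_gt0 // mulr_gt0 // subr_gt0.
move=> _ _ s t /ordered_graphP[a [b [ab rab ->]]] /ordered_graphP[c [d [cd rcd ->]]] ne.
rewrite !in_itv /= => s01 t01; rewrite !book_arcE // => E.
have [+ + acE acE'] := parabola_meet (lt_nat _ _ ab) (lt_nat _ _ cd) s01 t01 E.
have [_ _ caE caE'] := parabola_meet (lt_nat _ _ cd) (lt_nat _ _ ab) t01 s01 (esym E).
rewrite !ltr_nat in acE caE *.
move=> ad cb; case: (ltngtP a c) => [ac|ca|/val_inj ac].
- by have := ncr ac cb (acE ac) rab; rewrite rcd.
- by have := ncr ca ad (caE ca) rcd; rewrite rab.
- have /eqP : (b%:R : R) = d%:R by apply: acE'; rewrite ac.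
  by rewrite eqr_nat => /eqP/val_inj bd; move: ne; rewrite ac bd eqxx.
Qed.

(** The drawing lies in the closed lower half plane, so one unbounded face contains the open upper
    half plane and has all vertices on its boundary. *)
Lemma outerplanar_noncrossing : outerplanar R (ordered_graph n r).
Proof.
exists line_pos, book_arc.
set D := drawing _ _ _.
have D_le0 q : D q -> q.2 <= 0.
  case=> [[v _ <-]//|[_ /= /ordered_graphP[i [j [ij _ ->]]] [t]]].
  rewrite /= in_itv /= => /andP[t0 t1] <-; rewrite book_arcE //= oppr_le0.
  by rewrite mulr_ge0 ?exprn_ge0 ?subr_ge0 ?ler_nat ?(ltnW ij) // mulr_ge0 // subr_ge0.
pose z : plane := (0, 1).
have upper_face q : 0 < q.2 -> connected_component (~` D) z q.
  move=> q0; have zq : segment z q `<=` ~` D.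
    move=> p [t]; rewrite /= in_itv /= => /andP[t0 t1] <- /D_le0; apply/negP.
    have -> : (z + t *: (q - z)).2 = (1 - t) + t * q.2.
      by rewrite /= /GRing.scale /=; ring.
    rewrite -ltNge; have [->|tN0] := eqVneq t 0; first by rewrite mul0r; lra.
    have : 0 < t * q.2 by rewrite mulr_gt0 // lt_neqAle eq_sym tN0.
    lra.
  have := @connected_component_max _ (~` D) (segment z q) z (segmentl z q) zq.
  by apply; [exact: connected_segment|exact: segmentr].
exists (connected_component (~` D) z); split; first exact: book_embedding.
  split; first by exists z => // /D_le0 /=; rewrite ler10.
  move=> [M [_ /(_ (Num.max M 0 + 1))]].
  have -> : M < Num.max M 0 + 1 by rewrite (le_lt_trans _ (ltr_pwDr _ (lexx _))) // le_max lexx.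
  move=> /(_ isT) bd.
  have M0 : 0 <= Num.max M 0 by rewrite le_max lexx orbT.
  have pos : 0 < Num.max M 0 + 2 by lra.
  have /= := bd _ (upper_face (0, Num.max M 0 + 2) pos); apply/negP; rewrite -ltNge.
  rewrite prod_normE /= lt_max; apply/orP; right; rewrite ger0_norm; lra.
move=> v; split.
  move=> B /nbhs_norm_ballP[e e0 eB]; exists ((v : nat)%:R, e / 2); split.
    by apply: upper_face => /=; lra.
  apply: eB; rewrite norm_ltE /= subrr normr0 e0 subr0 /= ger0_norm; lra.
move=> /interior_subset/connected_component_sub; apply; left; by exists v.
Qed.

End BookDrawing.

(** * From edge bounds to the theorem *)

Lemma leq_max_edges (n : nat) (P : {set {set 'I_n}} -> Prop) (G : {set {set 'I_n}}) :
  simple_graph G -> P G -> (#|G| <= max_edges P)%N.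
Proof.
move=> sG PG; apply: (@leq_bigmax_cond _ _ (fun G : {set {set 'I_n}} => #|G|)).
by rewrite sG; apply/asboolP.
Qed.

Lemma max_edges_leq (n : nat) (P : {set {set 'I_n}} -> Prop) (m : nat) :
  (forall G, simple_graph G -> P G -> #|G| <= m)%N -> (max_edges P <= m)%N.
Proof. by move=> Pm; apply/bigmax_leqP => G /andP[sG /asboolP]; exact: Pm. Qed.

Theorem theorem3p1 (R : realType) (n k : nat) (hk : (4 <= k)%N) (hn : (k <= n)%N) :
  ex_OP R n k = maxn (ex_OP_connected R n k) (ex_OP_small R n k).
Proof.
apply/eqP; rewrite eqn_leq geq_max; apply/and3P; split.
- apply: max_edges_leq => G sG [oG fG].
  (* This is the integer with [2 * s + 2 <= k <= 2 * s + 3]: the right inequality serves the edge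
     bound, the left one the extremal graph. *)
  pose s := ((k - 2) %/ 2)%N.
  have s0 : (0 < s)%N by rewrite /s; lia.
  have sk : (2 * s + 2 <= k)%N by rewrite /s; lia.
  have edges_setT : edges_in G [set: 'I_n]%SET = G.
    by apply/setP => e; rewrite finset.in_set finset.subsetT andbT.
  have := @edge_dichotomy _ G k s sG (outerplanar_linked oG)
    (fun p => path_free_short fG) _ _ hk [set: 'I_n]%SET.
  rewrite edges_setT finset.cardsT card_ord => -[||[_ cb]|sb].
  + by rewrite /s; lia.
  + by rewrite /s; lia.
  + rewrite leq_max; apply/orP; left; apply: leq_trans (card_star_graph s0 sk hn cb) _.
    apply: leq_max_edges; first exact: simple_ordered_graph.
    split; [exact/outerplanar_noncrossing/noncrossing_star| |exact: star_graph_connected].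
    exact: star_graph_path_free.
  + have m2 : (2 < k - 1)%N by lia.
    have kE : k = (k - 1).+1 by lia.
    rewrite {1}kE in sb.
    rewrite leq_max; apply/orP; right; apply: leq_trans (card_block_graph sb) _.
    apply: leq_max_edges; first exact: simple_ordered_graph.
    split; [exact/outerplanar_noncrossing/noncrossing_blocks| |exact: card_block_component].
    by rewrite {1}kE; exact: block_graph_path_free.
- by apply: max_edges_leq => G sG [oG fG _]; apply: leq_max_edges.
- by apply: max_edges_leq => G sG [oG fG _]; apply: leq_max_edges.
Qed.
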